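(* Let $\alpha,\beta>0$, let $n$ be a positive integer, and let $\mathbf{g}=(g_0,g_1,\dots,g_{n-1})$ with $g_k\in H(\mathbb{D})$ for $0\le k\le n-1$. Define $I_{\mathbf{g}}^{(n)}f=I^n\left(fg_0+f'g_1+\cdots+f^{(n-1)}g_{n-1}\right)$ and, for $g\in H(\mathbb{D})$, $I_g^{n,k}f=I^n(f^{(k)}g)$. Then $I_{\mathbf{g}}^{(n)}:\mathcal{B}^{\alpha}\to\mathcal{B}^{\beta}$ is bounded (respectively compact) if and only if each $I_{g_k}^{n,k}:\mathcal{B}^{\alpha}\to\mathcal{B}^{\beta}$, $0\le k\le n-1$, is bounded (respectively compact).
   Context: $\mathbb{D}$ is the open unit disc in $\mathbb{C}$ and $H(\mathbb{D})$ the space of analytic functions on $\mathbb{D}$. For $\alpha>0$, $\mathcal{B}^{\alpha}$ is the Banach space of $f\in H(\mathbb{D})$ with $\|f\|_{\mathcal{B}^{\alpha}}=|f(0)|+\sup_{z\in\mathbb{D}}(1-|z|^2)^{\alpha}|f'(z)|<\infty$. $I$ is the integration operator $If(z)=\int_0^z f(\zeta)\,d\zeta$ and $I^n$ its $n$th iterate. An operator is bounded (compact) from $\mathcal{B}^\alpha$ to $\mathcal{B}^\beta$ if it maps $\mathcal{B}^\alpha$ into $\mathcal{B}^\beta$ and is bounded (compact) as a linear operator between these Banach spaces. *)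

(* Defs.v *)
(* R : realType, complex numbers R[i] from
   mathcomp-real-closed, viewed as the normed field R[i]^o over itself, so
   that [derivable]/[derive1] are complex derivatives. *)
From mathcomp Require Import all_boot all_order all_algebra.
From mathcomp Require Import complex.
From mathcomp Require Import all_classical all_reals all_analysis.
From Stdlib Require Import ClassicalEpsilon.
Set Implicit Arguments.
Unset Strict Implicit.
Unset Printing Implicit Defensive.
Import Order.TTheory GRing.Theory Num.Theory.
Import numFieldNormedType.Exports.
Local Open Scope ring_scope.
Local Open Scope classical_set_scope.

Section Bloch.
Variable R : realType.
Local Notation C := (R[i])^o.

Definition cmod (z : C) : R := Num.sqrt (complex.Re z ^+ 2 + complex.Im z ^+ 2).

Definition disc : set C := [set z | cmod z < 1].

Definition holo (f : C -> C) : Prop := forall z, disc z -> derivable f z 1.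

Definition dern (k : nat) (f : C -> C) : C -> C := derive1n k f.

Definition bloch_sup (a : R) (f : C -> C) : R :=
  sup [set (1 - cmod z ^+ 2) `^ a * cmod (derive1 f z) | z in disc].

Definition in_bloch (a : R) (f : C -> C) : Prop :=
  holo f /\ exists M : R, forall z, disc z ->
    (1 - cmod z ^+ 2) `^ a * cmod (derive1 f z) <= M.

Definition bloch_norm (a : R) (f : C -> C) : R := cmod (f 0) + bloch_sup a f.

(* integration operator: I f is the primitive of f on D vanishing at 0,
   i.e. I f (z) = int_0^z f(zeta) d zeta *)
Definition Iop (f : C -> C) : C -> C :=
  epsilon (inhabits (fun _ : C => 0 : C))
    (fun F : C -> C => holo F /\ F 0 = 0 /\ forall w, disc w -> derive1 F w = f w).

Definition Iopn (n : nat) (f : C -> C) : C -> C := iter n Iop f.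

Definition Ig (n : nat) (g : 'I_n -> C -> C) (f : C -> C) : C -> C :=
  Iopn n (fun z => \sum_(k < n) dern k f z * g k z).

Definition Ink (n k : nat) (g : C -> C) (f : C -> C) : C -> C :=
  Iopn n (fun z => dern k f z * g z).

Definition maps_into (a b : R) (T : (C -> C) -> (C -> C)) : Prop :=
  forall f, in_bloch a f -> in_bloch b (T f).

Definition bounded_op (a b : R) (T : (C -> C) -> (C -> C)) : Prop :=
  maps_into a b T /\
  exists K : R, forall f, in_bloch a f -> bloch_norm b (T f) <= K * bloch_norm a f.

Definition compact_op (a b : R) (T : (C -> C) -> (C -> C)) : Prop :=
  maps_into a b T /\
  forall u : nat -> (C -> C),
    (forall j, in_bloch a (u j)) ->
    (exists M : R, forall j, bloch_norm a (u j) <= M) ->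
    exists phi : nat -> nat, (forall j, (phi j < phi j.+1)%N) /\
    exists h : C -> C, in_bloch b h /\
      (fun j => bloch_norm b (fun z => T (u (phi j)) z - h z)) @ \oo --> (0 : R).

End Bloch.

(* Main.v *)
Require Import Defs.
From mathcomp Require Import all_boot all_order all_algebra.
From mathcomp Require Import complex.
From mathcomp Require Import all_classical all_reals all_analysis.
From mathcomp Require Import ring lra.
From Stdlib Require Import ClassicalEpsilon.
Set Implicit Arguments.
Unset Strict Implicit.
Unset Printing Implicit Defensive.
Import Order.TTheory GRing.Theory Num.Theory.
Import numFieldNormedType.Exports.
Local Open Scope ring_scope.
(* Integrating n times turns boundedness from B^alpha to B^beta of f |-> I^n (L f)
   into the estimate sup (1-|z|^2)^(beta+n-1) |L f (z)| <= K ||f||, by Cauchy's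
   estimates in one direction and radial integration in the other; compactness
   translates likewise.  The operators f^(k) g_k are then split off the sum from the
   highest order m downwards: a test function which is bounded in B^alpha and vanishes
   at a to the exact order m makes the partial sum at a reduce to the single term
   f^(m)(a) g_m(a), so that (1-|a|^2)^(beta+n-alpha-m) |g_m(a)| is bounded, and
   tends to 0 as |a| -> 1 in the compact case.  When m >= 1 this is sufficient for
   f |-> f^(m) g_m to be bounded, respectively (by Montel's theorem) compact, and
   subtracting it leaves a shorter sum; at m = 0 the sum is the operator itself.

   The function theory needed is obtained from Goursat's lemma.  For a primitive F of f,
   rho f(w) is the mean of F(w + rho u) u^-1 over the unit circle u, and
   rho^2 f'(w) is twice the mean of F(w + rho u) u^-2, which gives differentiability
   of f' and Cauchy's estimate.  Limits are taken along a free ultrafilter on nat,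
   which avoids diagonal subsequences. *)

(** The descending order is forced: a zero at [a] removes the terms of lower order there, but none
    of higher order. Order 0 is exceptional because of growth in B^alpha. For k >= 1 the derivative
    f^(k) grows at most like (1-|z|^2)^-(alpha+k-1), whatever alpha > 0 is, and the test functions
    attain this rate at [a]; hence one pointwise condition on g_k is both necessary and sufficient.
    On the target side beta > 0 keeps radial integration away from the logarithmic exponent. The
    code writes the order as [m.+1] and the number of integrations as [n.+1], which gives the
    exponents [alpha + m] and [beta + n]. An integer [p >= alpha] makes the kernels of the test
    functions integral powers, so that only the positive number 1-|a|^2 receives a real exponent. *)

Section Modulus.
Variable R : realType.
Local Notation C := (R[i])^o.
Implicit Types (x y z : C) (r : R).

Lemma cmodE z : cmod z = Normc.normc (z : R[i]).
Proof. by rewrite /cmod; case: z. Qed.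

Lemma cmodM x y : cmod (x * y) = cmod x * cmod y.
Proof. by rewrite !cmodE; apply: Normc.normcM. Qed.

Lemma cmodN x : cmod (- x) = cmod x.
Proof. by rewrite !cmodE; apply: normcN. Qed.

Lemma cmodV x : cmod x^-1 = (cmod x)^-1.
Proof. by rewrite !cmodE; apply: Normc.normcV. Qed.

Lemma cmod1 : cmod (1 : C) = 1.
Proof. by rewrite !cmodE; apply: Normc.normc1. Qed.

Lemma cmodX x n : cmod (x ^+ n) = cmod x ^+ n.
Proof. by elim: n => [|n IH]; rewrite ?expr0 ?cmod1// !exprS cmodM IH. Qed.

Lemma cmodD x y : cmod (x + y) <= cmod x + cmod y.
Proof. by rewrite !cmodE; apply: le_normcD. Qed.

Lemma cmod_ge0 x : 0 <= cmod x.
Proof. exact: sqrtr_ge0. Qed.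

Lemma cmod0 : cmod (0 : C) = 0.
Proof. by rewrite !cmodE; apply: Normc.normc0. Qed.

Lemma cmod_eq0 x : (cmod x == 0) = (x == 0).
Proof.
apply/eqP/eqP => [|->]; last exact: cmod0.
by rewrite cmodE => /Normc.eq0_normc.
Qed.

Lemma cmod_gt0 x : (0 < cmod x) = (x != 0).
Proof. by rewrite lt_def cmod_eq0 cmod_ge0 andbT. Qed.

Lemma cmod_real r : cmod (r%:C%C : C) = `|r|.
Proof. by rewrite /cmod /= expr0n /= addr0 sqrtr_sqr. Qed.

Lemma cmodB x y : cmod (x - y) <= cmod x + cmod y.
Proof. by rewrite -(cmodN y); apply: cmodD. Qed.

Lemma cmodBC x y : cmod (x - y) = cmod (y - x).
Proof. by rewrite -cmodN opprB. Qed.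

Lemma cmod_sub x y : cmod x - cmod y <= cmod (x - y).
Proof. by rewrite lerBlDr -{1}(subrK y x) cmodD. Qed.

Lemma cmod_sum (I : finType) (P : pred I) (F : I -> C) :
  cmod (\sum_(i | P i) F i) <= \sum_(i | P i) cmod (F i).
Proof.
elim/big_ind2 : _ => [|u v a b uv ab|i _] //; first by rewrite cmod0.
by apply: (le_trans (cmodD _ _)); apply: lerD.
Qed.

Lemma normr_Re_le z : `|complex.Re z| <= cmod z.
Proof. by rewrite -sqrtr_sqr /cmod ler_sqrt ?addr_ge0 ?sqr_ge0// lerDl sqr_ge0. Qed.

Lemma normr_Im_le z : `|complex.Im z| <= cmod z.
Proof. by rewrite -sqrtr_sqr /cmod ler_sqrt ?addr_ge0 ?sqr_ge0// lerDr sqr_ge0. Qed.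

Lemma cmod_le_ReIm z : cmod z <= `|complex.Re z| + `|complex.Im z|.
Proof.
have -> : z = (complex.Re z)%:C%C + 'i%C * (complex.Im z)%:C%C :> C.
  by case: z => a b; apply/eqP; rewrite eq_complex /=; apply/andP; split; apply/eqP; ring.
apply: (le_trans (cmodD _ _)); rewrite cmodM !cmod_real.
suff -> : cmod ('i%C : C) = 1 by case: z => a b /=; rewrite !mul0r !mul1r !(mulr0,addr0,add0r,subr0,sub0r).
by rewrite /cmod /= expr0n add0r expr1n sqrtr1.
Qed.

End Modulus.

(** * Derivatives of functions and of curves *)

(* Differentiability along the additive map [J] from [V] to C: complex
   derivatives are [J = id], derivatives of curves [J = real_complex]. *)
Section Der.
Variable R : realType.
Local Notation C := (R[i])^o.

Definition der (V : zmodType) (J : V -> C) (f : V -> C) (z : V) (l : C) :=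
  forall e : R, 0 < e -> exists2 d : R, 0 < d &
    forall h : V, cmod (J h) < d ->
      cmod (f (z + h) - f z - J h * l) <= e * cmod (J h).

Definition cder := @der C id.
Definition rder := @der R (fun t => t%:C%C).

Section DerRules.
Variables (V : zmodType) (J : V -> C).

Lemma der_lip (f : V -> C) z l : der J f z l -> exists2 d : R, 0 < d &
  forall h, cmod (J h) < d -> cmod (f (z + h) - f z) <= (1 + cmod l) * cmod (J h).
Proof.
move=> /(_ 1 ltr01)[d d0 H]; exists d => // h hd; move: (H _ hd) => {}H.
rewrite -[leLHS](congr1 (@cmod R) (subrK (J h * l) (f (z + h) - f z))).
apply: (le_trans (cmodD _ _)); rewrite mulrDl; apply: lerD => //; by rewrite cmodM mulrC.
Qed.

Lemma der_cst c z : der J (fun=> c) z 0.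
Proof.
move=> e e0; exists 1 => // h _.
by rewrite subrr mulr0 subrr cmod0 mulr_ge0 ?cmod_ge0 ?ltW.
Qed.

Lemma derD (f g : V -> C) z l m : der J f z l -> der J g z m ->
  der J (fun x => f x + g x) z (l + m).
Proof.
move=> F G e e0; have e2 : 0 < e / 2 by rewrite divr_gt0.
have [d1 d10 {}F] := F _ e2; have [d2 d20 {}G] := G _ e2.
exists (Num.min d1 d2); first by rewrite lt_min d10.
move=> h; rewrite lt_min => /andP[/F fh /G gh].
rewrite (_ : _ - _ = (f (z + h) - f z - J h * l) + (g (z + h) - g z - J h * m)); last by ring.
by apply: (le_trans (cmodD _ _)); rewrite (splitr e) mulrDl lerD.
Qed.

Lemma derM (f g : V -> C) z l m : der J f z l -> der J g z m ->
  der J (fun x => f x * g x) z (l * g z + f z * m).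
Proof.
move=> F G e e0.
have [d3 d30 L] := der_lip F.
have [d4 d40 L'] := der_lip G.
(* The summand 1 keeps these bounds positive, so that they can serve as divisors in the choice of
   the radii. *)
pose A := 1 + cmod l; pose B := 1 + cmod m; pose Cf := 1 + cmod (f z); pose Cg := 1 + cmod (g z).
have A0 : 0 < A by rewrite ltr_pwDl ?cmod_ge0.
have B0 : 0 < B by rewrite ltr_pwDl ?cmod_ge0.
have Cf0 : 0 < Cf by rewrite ltr_pwDl ?cmod_ge0.
have Cg0 : 0 < Cg by rewrite ltr_pwDl ?cmod_ge0.
have e3 : 0 < e / 3 by rewrite divr_gt0.
have [d1 d10 {}F] := F _ (divr_gt0 e3 Cg0); have [d2 d20 {}G] := G _ (divr_gt0 e3 Cf0).
exists (Num.min (Num.min d1 d2) (Num.min (Num.min d3 d4) (e / 3 / (A * B)))).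
  by rewrite !lt_min d10 d20 d30 d40/= divr_gt0// mulr_gt0.
move=> h; rewrite !lt_min => /andP[/andP[/F fh /G gh] /andP[/andP[/L lf /L' lg] hd]].
(* Besides the two first-order errors only the product of the increments remains; the Lipschitz
   bounds make it of second order in [J h]. *)
rewrite (_ : _ - _ = (f (z + h) - f z - J h * l) * g z + (f z * (g (z + h) - g z - J h * m) +
   (f (z + h) - f z) * (g (z + h) - g z))); last by ring.
have h0 := cmod_ge0 (J h).
have -> : e * cmod (J h) = (e / 3) * cmod (J h) + ((e / 3) * cmod (J h) + (e / 3) * cmod (J h)) by field.
apply: (le_trans (cmodD _ _)); apply: lerD; last (apply: (le_trans (cmodD _ _)); apply: lerD).
- rewrite cmodM; apply: (@le_trans _ _ (e / 3 / Cg * cmod (J h) * Cg)).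
    by apply: ler_pM => //; rewrite ?cmod_ge0// /Cg lerDr.
  by rewrite mulrAC divfK// gt_eqF.
- rewrite cmodM; apply: (@le_trans _ _ (Cf * (e / 3 / Cf * cmod (J h)))).
    by apply: ler_pM => //; rewrite ?cmod_ge0// /Cf lerDr.
  by rewrite mulrA [Cf * _]mulrC divfK// gt_eqF.
- rewrite cmodM; apply: (@le_trans _ _ (A * cmod (J h) * (B * cmod (J h)))).
    by apply: ler_pM => //; rewrite ?cmod_ge0.
  rewrite mulrACA mulrA ler_wpM2r// mulrC -ler_pdivlMr ?mulr_gt0//; exact: ltW.
Qed.

Lemma der_comp (f : C -> C) (g : V -> C) z l m :
  der J g z m -> cder f (g z) l -> der J (fun x => f (g x)) z (l * m).
Proof.
move=> G F e e0.
have [d3 d30 L] := der_lip G.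
pose A := 1 + cmod l; pose B := 1 + cmod m.
have A0 : 0 < A by rewrite ltr_pwDl ?cmod_ge0.
have B0 : 0 < B by rewrite ltr_pwDl ?cmod_ge0.
have e2 : 0 < e / 2 by rewrite divr_gt0.
have [d1 d10 {}F] := F _ (divr_gt0 e2 B0); have [d2 d20 {}G] := G _ (divr_gt0 e2 A0).
exists (Num.min (d1 / B) (Num.min d2 d3)).
  by rewrite !lt_min d20 d30 andbT divr_gt0.
move=> h; rewrite !lt_min => /andP[hd /andP[/G gh /L lg]].
have kd : cmod (g (z + h) - g z) < d1.
  by apply: (le_lt_trans lg); rewrite mulrC -ltr_pdivlMr.
have := F _ kd; rewrite [g z + _]addrC subrK => fh.
rewrite (_ : _ - _ = (f (g (z + h)) - f (g z) - (g (z + h) - g z) * l) +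
   (g (z + h) - g z - J h * m) * l); last by ring.
have h0 := cmod_ge0 (J h).
have -> : e * cmod (J h) = e / 2 * cmod (J h) + e / 2 * cmod (J h) by field.
apply: (le_trans (cmodD _ _)); apply: lerD.
  apply: (le_trans fh).
  apply: (@le_trans _ _ (e / 2 / B * (B * cmod (J h)))); last by rewrite mulrA divfK// gt_eqF.
  by apply: ler_wpM2l => //; rewrite ltW// divr_gt0.
rewrite cmodM; apply: (@le_trans _ _ (e / 2 / A * cmod (J h) * A)).
  by apply: ler_pM => //; rewrite ?cmod_ge0// /A lerDr.
by rewrite mulrAC divfK// gt_eqF.
Qed.

Lemma derZ c (f : V -> C) z l : der J f z l -> der J (fun x => c * f x) z (c * l).
Proof. by move=> /(derM (der_cst c z)); rewrite mul0r add0r. Qed.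

Lemma derN (f : V -> C) z l : der J f z l -> der J (fun x => - f x) z (- l).
Proof.
move=> /(derZ (-1)); rewrite mulN1r.
by rewrite (_ : (fun x => -1 * f x) = (fun x => - f x))//; apply/funext => x; rewrite mulN1r.
Qed.

Lemma derB (f g : V -> C) z l m : der J f z l -> der J g z m ->
  der J (fun x => f x - g x) z (l - m).
Proof. by move=> F /derN G; apply: derD F G. Qed.

Lemma der_sum (I : finType) (F : I -> V -> C) z (l : I -> C) :
  (forall i, der J (F i) z (l i)) -> der J (fun x => \sum_i F i x) z (\sum_i l i).
Proof.
move=> H; rewrite (_ : (fun x => _) = \sum_i F i); last first.
  by apply/funext => x; rewrite fct_sumE.
elim/big_ind2 : _ => [|f u g v fu gv|i _] //; first exact: (der_cst 0).
exact: derD.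
Qed.

Lemma der_eq_near (f g : V -> C) z l r : 0 < r ->
  (forall h, cmod (J h) < r -> g (z + h) = f (z + h)) -> J 0 = 0 ->
  der J f z l -> der J g z l.
Proof.
move=> r0 fg J0 F e e0; have [d d0 {}F] := F _ e0.
exists (Num.min r d); first by rewrite lt_min r0.
move=> h; rewrite lt_min => /andP[hr /F]; rewrite fg//.
by have := fg 0; rewrite J0 cmod0 addr0 => ->.
Qed.

End DerRules.

Lemma cder_id (z : C) : cder id z 1.
Proof.
move=> e e0; exists 1 => // h _.
by rewrite /= mulr1 addrAC addrK subrr cmod0 mulr_ge0 ?cmod_ge0 ?ltW.
Qed.

Lemma rder_id (t : R) : rder (fun t => t%:C%C) t 1.
Proof.
move=> e e0; exists 1 => // h _.
by rewrite mulr1 rmorphD /= addrAC addrK subrr cmod0 mulr_ge0 ?cmod_ge0 ?ltW.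
Qed.

Lemma cder_inv (z : C) : z != 0 -> cder (fun x => x^-1) z (- z ^- 2).
Proof.
move=> z0 e e0; have c0 : 0 < cmod z by rewrite cmod_gt0.
(* The first radius keeps [cmod (z + h)] above [cmod z / 2]; the second then makes the remainder
   [h ^+ 2 / (z ^+ 2 * (z + h))] at most [e * cmod h]. *)
exists (Num.min (cmod z / 2) (e * (cmod z ^+ 3) / 2)).
  by rewrite lt_min !divr_gt0// mulr_gt0// exprn_gt0.
move=> h; rewrite lt_min => /andP[h1 h2].
have zh : cmod z / 2 <= cmod (z + h).
  have := cmod_sub (z + h) h; rewrite addrK; have := cmod_ge0 (z+h).
  have := cmod_sub z (-h); rewrite opprK cmodN; lra.
have zh0 : z + h != 0 by rewrite -cmod_gt0; apply: lt_le_trans zh; rewrite divr_gt0.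
rewrite (_ : _ - _ = h * (h / (z ^+ 2 * (z + h)))); last by field; rewrite zh0 z0.
rewrite cmodM mulrC ler_wpM2r ?cmod_ge0// cmodM cmodV cmodM cmodX.
rewrite ler_pdivrMr; last by rewrite mulr_gt0 ?exprn_gt0// cmod_gt0.
apply: (le_trans (ltW h2)).
have -> : e * cmod z ^+ 3 / 2 = e * (cmod z ^+ 2 * (cmod z / 2)) by field.
apply: ler_wpM2l; first exact: ltW.
by apply: ler_wpM2l => //; rewrite exprn_ge0 ?cmod_ge0.
Qed.

Lemma cder_exp (z : C) n : cder (fun x => x ^+ n) z (n%:R * z ^+ n.-1).
Proof.
elim: n => [|n IH].
  rewrite mul0r; rewrite (_ : (fun x => _) = fun=> 1); first exact: der_cst.
  by apply/funext => x; rewrite expr0.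
have := derM (cder_id z) IH.
rewrite (_ : (fun x => x * x ^+ n) = fun x => x ^+ n.+1); last by apply/funext => x; rewrite exprS.
rewrite (_ : 1 * _ + _ = n.+1%:R * z ^+ n)//.
case: n {IH} => [|n] /=; first by rewrite !expr0; ring.
by rewrite exprS -[n.+2%:R]natr1; ring.
Qed.

Lemma der_uniq (V : zmodType) (J : V -> C) (f : V -> C) z l m :
  (forall d : R, 0 < d -> exists2 h, J h != 0 & cmod (J h) < d) ->
  der J f z l -> der J f z m -> l = m.
Proof.
move=> HJ /derN F G; have {F G} := derD F G.
rewrite (_ : (fun x => _) = fun=> 0); last by apply/funext => x; rewrite addNr.
move=> H; apply/eqP; rewrite eq_sym -subr_eq0 -cmod_eq0 addrC; apply/negP => /negP; rewrite cmod_eq0 -cmod_gt0 => lm.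
have [d d0 {}H] := H _ (divr_gt0 lm (ltr0Sn R 1)).
have [h h0 hd] := HJ _ d0; have := H _ hd.
rewrite subrr sub0r cmodN cmodM; rewrite -cmod_gt0 in h0.
rewrite [leRHS]mulrC ler_pM2l//; lra.
Qed.

Lemma cder_uniq (f : C -> C) z l m : cder f z l -> cder f z m -> l = m.
Proof.
apply: der_uniq => d d0; exists ((d / 2)%:C%C); first by rewrite -cmod_gt0 cmod_real gtr0_norm divr_gt0.
by rewrite cmod_real gtr0_norm ?divr_gt0//; lra.
Qed.

End Der.

(** Stated over any [numFieldType] so that it serves both [R] and [R[i]], where norms and [e] are
    elements of the field itself. Multiplying by [h] turns the limit of difference quotients into an
    inequality that includes [h = 0]. *)
Lemma is_derive_epsP (K : numFieldType) (f : K^o -> K^o) (z l : K^o) :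
  is_derive z (1 : K^o) f l <->
  forall e : K, 0 < e -> exists2 d : K, 0 < d &
    forall h : K^o, `|h| < d -> `|f (z + h) - f z - h * l| <= e * `|h|.
Proof.
have key (h m : K^o) : h != 0 -> `|f (z + h) - f z - h * m| = `|h| * `|m - h^-1 * (f (h *: 1 + z) - f z)|.
  move=> h0; rewrite -normrM -normrN; congr `|_|.
  by rewrite /GRing.scale/= mulr1 [h + z]addrC mulrBr mulVKf//; ring.
split=> [[+ <-]|H].
  rewrite /derivable => /cvgrPdist_le H e e0.
  have /nbhs_ballP[d/= d0 {}H] := H e e0; exists d => // h hd.
  have [->|h0] := eqVneq h 0; first by rewrite addr0 subrr mul0r subrr normr0 mulr0.
  rewrite key//.
  rewrite mulrC ler_wpM2r//; apply: H => //.
  by rewrite -ball_normE /= sub0r normrN.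
have cv : ((fun h => h^-1 *: ((f \o shift z) (h *: 1) - f z)) @ 0^' --> l)%classic.
  apply/cvgrPdist_le => e e0; have [d d0 {}H] := H e e0.
  apply/nbhs_ballP; exists d => // h; rewrite -ball_normE /= sub0r normrN => hd h0.
  by have := H _ hd; rewrite key// mulrC ler_pM2r// normr_gt0.
split; last exact: cvg_lim.
by rewrite /derivable; apply/cvg_ex; exists l.
Qed.

(** * Passage to library derivatives, and the mean value inequality for curves *)

Section Links.
Variable R : realType.
Local Notation C := (R[i])^o.

Lemma cmod_lt (z : C) (d : R) : (`|z : R[i]| < d%:C%C) = (cmod z < d).
Proof. by rewrite cmodE -ltcR. Qed.

Lemma cmod_le (z : C) (d : R) : (`|z : R[i]| <= d%:C%C) = (cmod z <= d).
Proof. by rewrite cmodE -lecR. Qed.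

Lemma pos_complex (e : R[i]) : 0 < e -> exists2 d : R, 0 < d & e = d%:C%C.
Proof.
by case: e => a b; rewrite ltcE /= => /andP[/eqP -> a0]; exists a.
Qed.

Lemma cderP (f : C -> C) z l : is_derive z (1 : C) f l <-> cder f z l.
Proof.
split=> [/is_derive_epsP H e e0|H].
  have [|d] := H e%:C%C; first by rewrite ltcR.
  move=> /pos_complex[d' d0 ->] {}H; exists d' => // h hd.
  have := H h; rewrite cmod_lt => /(_ hd).
  by rewrite -cmod_le rmorphM /= cmodE.
apply/is_derive_epsP => e /pos_complex[e' e0 ->].
have [d d0 {}H] := H e' e0; exists d%:C%C; first by rewrite ltcR.
move=> h; rewrite cmod_lt => /H.
by rewrite -cmod_le rmorphM /= cmodE.
Qed.

Lemma cder_derive1 (f : C -> C) z l : cder f z l -> derivable f z 1 /\ derive1 f z = l.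
Proof.
move=> /cderP[H E]; split; first exact: H.
by rewrite -E; exact: (derive1E f z).
Qed.

Lemma derivable_cder (f : C -> C) z : derivable f z 1 -> cder f z (derive1 f z).
Proof.
move=> H; apply/cderP.
by rewrite (derive1E f z); apply: DeriveDef.
Qed.

Lemma rder_real (k : R -> R) (t l : R) :
  is_derive t (1 : R) k l <-> rder (fun s => (k s)%:C%C) t l%:C%C.
Proof.
have cE (a b h l' : R) : cmod (a%:C%C - b%:C%C - h%:C%C * l'%:C%C : C) = `|a - b - h * l'|.
  by rewrite -rmorphM -!rmorphB cmod_real.
split=> [/(@is_derive_epsP R) H e e0|H].
  have [d d0 {}H] := H e e0; exists d => // h.
  by rewrite cmod_real => /H; rewrite cE.
apply/(@is_derive_epsP R) => e e0.
have [d d0 {}H] := H e e0; exists d => // h.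
by have := H h; rewrite cmod_real cE.
Qed.

Lemma rder_Re (K : R -> C) (t : R) (l : C) :
  rder K t l -> is_derive t (1 : R) (fun s => complex.Re (K s)) (complex.Re l).
Proof.
move=> H; apply/rder_real => e e0; have [d d0 {}H] := H e e0.
exists d => // h /H; apply: le_trans.
rewrite -rmorphM -!rmorphB cmod_real.
suff -> : forall (x y w : C) (r : R), complex.Re x - complex.Re y - r * complex.Re w =
    complex.Re (x - y - r%:C%C * w) by exact: normr_Re_le.
by case=> a b [c d'] [p q] r /=; ring.
Qed.

(** A unimodular factor [u] rotates [K 1 - K 0] onto the nonnegative real axis; the real mean value
    theorem is then applied to [phi] minus the real part of [u * K], whose derivative is
    nonnegative. *)
Lemma rder_le (K : R -> C) (k : R -> C) (phi dphi : R -> R) :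
  (forall t : R, 0 <= t <= 1 -> rder K t (k t)) ->
  (forall t : R, 0 <= t <= 1 -> is_derive t (1 : R) phi (dphi t)) ->
  (forall t : R, 0 <= t <= 1 -> cmod (k t) <= dphi t) ->
  cmod (K 1 - K 0) <= phi 1 - phi 0.
Proof.
move=> HK Hphi Hle.
have [u u1 uE] : exists2 u : C, cmod u = 1 & u * (K 1 - K 0) = (cmod (K 1 - K 0))%:C%C.
  have [->|c0] := eqVneq (K 1 - K 0) 0.
    by exists 1; rewrite ?cmod1// cmod0 mulr0.
  exists ((cmod (K 1 - K 0))%:C%C / (K 1 - K 0)); last by rewrite divfK.
  by rewrite cmodM cmodV cmod_real ger0_norm ?cmod_ge0// divff// cmod_eq0.
pose psi t := phi t - complex.Re (u * K t).
have D (t : R) : 0 <= t <= 1 -> is_derive t (1 : R) psi (dphi t - complex.Re (u * k t)).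
  move=> t01; apply: is_deriveB; first exact: Hphi.
  by apply: rder_Re; apply: derZ; apply: HK.
have [c| |c c01] := @MVT_segment R psi (fun t => dphi t - complex.Re (u * k t)) 0 1 ler01.
- by rewrite in_itv /= => /andP[/ltW c0 /ltW c1]; apply: D; rewrite c0.
- by apply: derivable_within_continuous => t; rewrite in_itv /= => /D[].
rewrite subr0 mulr1 => E.
have c01' : 0 <= c <= 1 by move: c01; rewrite in_itv.
have : 0 <= psi 1 - psi 0.
  rewrite E subr_ge0; apply: (le_trans _ (Hle c c01')).
  apply: (le_trans (ler_norm _)); apply: (le_trans (normr_Re_le _)).
  by rewrite cmodM u1 mul1r.
rewrite /psi => h.
have <- : complex.Re (u * (K 1 - K 0)) = cmod (K 1 - K 0) by rewrite uE.
rewrite mulrBr (raddfB (@complex.Re R)) /=; lra.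
Qed.
End Links.

(** * Limits along an ultrafilter *)

Section UltraLimit.
Variable R : realType.
Local Notation C := (R[i])^o.
Local Open Scope classical_set_scope.

(** Containing [\oo] excludes principal ultrafilters: every member of [U] has arbitrarily large
    elements. *)
Definition free_ultra (U : set_system nat) := UltraFilter U /\ \oo `<=` U.

Lemma free_ultra_ex : exists U, free_ultra U.
Proof. by have [U [UU ooU]] := ultraFilterLemma eventually_filter; exists U. Qed.

Lemma free_ultra_ge U (N : nat) : free_ultra U -> U [set i | (N <= i)%N].
Proof. by move=> [_ +]; apply; apply: nbhs_infty_ge. Qed.

Lemma free_ultra_inv U (e : R) : free_ultra U -> 0 < e -> U [set i | i.+1%:R^-1 < e].
Proof.
move=> HU e0; have := free_ultra_ge (Num.bound e^-1) HU.
have FU : Filter U by case: HU => -[[]].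
apply: filterS => i /= hi; rewrite invf_plt ?posrE ?ltr0n//.
have e0' : 0 <= e^-1 by rewrite invr_ge0 ltW.
apply: (lt_le_trans (archi_boundP e0')); rewrite ler_nat; exact: leqW.
Qed.

Definition ucvg (U : set_system nat) (x : nat -> C) (l : C) :=
  forall e : R, 0 < e -> U [set i | cmod (x i - l) < e].

Variable U : set_system nat.
Hypothesis HU : free_ultra U.

Let UU : UltraFilter U. Proof. by case: HU. Qed.
Let PU : ProperFilter U. Proof. by case: UU. Qed.
Let FU : Filter U. Proof. by case: PU. Qed.
Local Existing Instance FU.
Local Existing Instance PU.

(** The limit is the supremum of the [y] that lie below [x i] for [U]-almost all [i]. Since
    [sup S + e / 2] is not such a [y], the ultrafilter property puts the complementary set of
    indices in [U]. *)
Lemma ultra_real (x : nat -> R) (M : R) : (forall i, `|x i| <= M) ->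
  exists l : R, forall e : R, 0 < e -> U [set i | `|x i - l| < e].
Proof.
move=> HM; pose S := [set y : R | U [set i | y <= x i]].
have S0 : S (- M).
  rewrite /S /= (_ : [set i | _] = setT); first exact: filterT.
  by apply/seteqP; split=> // i _ /=; have := HM i; rewrite ler_norml => /andP[].
have Sub : ubound S M.
  move=> y /filter_ex[i /= yi]; apply: (le_trans yi).
  by have := HM i; rewrite ler_norml => /andP[].
have hS : has_sup S by split; [exists (- M) | exists M].
exists (sup S) => e e0.
have [y Sy ylt] := sup_adherent e0 hS.
have nS : ~ S (sup S + e / 2).
  by move=> /(ub_le_sup (proj2 hS)); have := divr_gt0 e0 (ltr0Sn R 1); lra.
have := in_ultra_setVsetC [set i | sup S + e / 2 <= x i] UU.
case=> [//|A]; near=> i; rewrite /= ltr_norml.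
have h1 : y <= x i by near: i; exact: Sy.
have h2 : ~ (sup S + e / 2 <= x i) by near: i; exact: A.
move/negP: h2; rewrite -ltNge => h2; apply/andP; split; lra.
Unshelve. all: by end_near.
Qed.

Lemma ultra_bounded (x : nat -> C) (M : R) : (forall i, cmod (x i) <= M) ->
  exists l, ucvg U x l.
Proof.
move=> HM.
have [a Ha] := @ultra_real (fun i => complex.Re (x i)) M (fun i => le_trans (normr_Re_le _) (HM i)).
have [b Hb] := @ultra_real (fun i => complex.Im (x i)) M (fun i => le_trans (normr_Im_le _) (HM i)).
exists (a +i* b)%C => e e0; have e2 : 0 < e / 2 by rewrite divr_gt0.
near=> i => /=; apply: (le_lt_trans (cmod_le_ReIm _)).
have h1 : `|complex.Re (x i) - a| < e / 2 by near: i; exact: Ha.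
have h2 : `|complex.Im (x i) - b| < e / 2 by near: i; exact: Hb.
move: h1 h2; case: (x i) => c d /=; lra.
Unshelve. all: by end_near.
Qed.

Lemma ucvg_le x l (M : R) : ucvg U x l -> (forall i, cmod (x i) <= M) -> cmod l <= M.
Proof.
move=> H HM; apply/ler_addgt0Pr => e e0.
have [i /= hi] := filter_ex (H e e0); have := HM i.
have := cmod_sub l (x i); rewrite cmodBC; lra.
Qed.

Lemma ucvgD x y l m : ucvg U x l -> ucvg U y m -> ucvg U (fun i => x i + y i) (l + m).
Proof.
move=> X Y e e0; have e2 : 0 < e / 2 by rewrite divr_gt0.
near=> i => /=.
have h1 : cmod (x i - l) < e / 2 by near: i; exact: X.
have h2 : cmod (y i - m) < e / 2 by near: i; exact: Y.
rewrite (_ : _ - _ = (x i - l) + (y i - m)); last by ring.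
apply: (le_lt_trans (cmodD _ _)); lra.
Unshelve. all: by end_near.
Qed.

Lemma ucvgZ c x l : ucvg U x l -> ucvg U (fun i => c * x i) (c * l).
Proof.
move=> X e e0; have c0 : 0 < 1 + cmod c by rewrite ltr_pwDl ?cmod_ge0.
have e2 : 0 < e / (1 + cmod c) by rewrite divr_gt0.
apply: filterS (X _ e2) => i /=; rewrite ltr_pdivlMr// -mulrBr cmodM.
apply: le_lt_trans; rewrite mulrC ler_wpM2l ?cmod_ge0//; lra.
Qed.

Lemma ucvgB x y l m : ucvg U x l -> ucvg U y m -> ucvg U (fun i => x i - y i) (l - m).
Proof.
move=> X /(ucvgZ (-1)) Y; have := ucvgD X Y; rewrite mulN1r.
by rewrite (_ : (fun i => x i + -1 * y i) = fun i => x i - y i)//; apply/funext => i; rewrite mulN1r.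
Qed.

End UltraLimit.

(* Compactness of closed discs in Lebesgue-number form. *)
Lemma closed_disc_uniform (R : realType) (r : R) (P : (R[i])^o -> R -> Prop) :
  (forall z d d', P z d -> d' <= d -> P z d') ->
  (forall z : (R[i])^o, cmod z <= r -> exists2 d : R, 0 < d &
     forall w, cmod w <= r -> cmod (w - z) < d -> P w d) ->
  exists2 d : R, 0 < d & forall w, cmod w <= r -> P w d.
Proof.
move=> mono H; apply: contrapT => Hn.
(* Failure at every scale gives points [w i]; near their limit [l] the local radius [d] of [l]
   works, and monotonicity of [P] contradicts the choice of [w i] once [i.+1%:R^-1 < d]. *)
have [w Hw] : {w : nat -> (R[i])^o & forall i, cmod (w i) <= r /\ ~ P (w i) i.+1%:R^-1}.
  apply: (@boolp.choice _ _ (fun i z => cmod z <= r /\ ~ P z i.+1%:R^-1)) => i; apply: contrapT => Hi; apply: Hn.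
  exists i.+1%:R^-1; first by rewrite invr_gt0 ltr0n.
  by move=> z zr; apply: contrapT => Pz; apply: Hi; exists z.
have [U HU] := free_ultra_ex.
have [l Hl] := ultra_bounded HU (fun i => proj1 (Hw i)).
have lr : cmod l <= r := ucvg_le HU Hl (fun i => proj1 (Hw i)).
have [d d0 Hd] := H l lr.
have PU : ProperFilter U by case: HU => -[].
have [i [/= h1 h2]] := filter_ex (filterI (Hl d d0) (free_ultra_inv HU d0)).
have [wr] := Hw i; apply; apply: mono (ltW h2); exact: Hd.
Qed.

(** * Integrals over the unit interval *)

Section Primitive.
Variable R : realType.
Local Notation C := (R[i])^o.

Lemma real_primitive (k : R -> R) :
  (forall t : R, 0 <= t <= 1 -> derivable k t 1) ->
  exists K : R -> R, forall t : R, 0 <= t <= 1 -> is_derive t (1 : R) K (k t).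
Proof.
(* Clamping makes the integrand continuous on the whole line, and integrating inside [-1, 2] makes 0
   and 1 interior points, where the derivative is two-sided. *)
move=> Hk; pose clamp (t : R) : R := Num.max 0 (Num.min t 1).
have clamp01 t : 0 <= clamp t <= 1.
  by rewrite /clamp le_max lexx /= ge_max ler01 ge_min lexx orbT.
have clamp_id t : 0 <= t <= 1 -> clamp t = t.
  by move=> /andP[t0 t1]; rewrite /clamp min_l// max_r.
pose f := k \o clamp.
have cf : continuous f.
  move=> t; apply: (@continuous_comp _ _ _ clamp k).
    apply: (@continuous_max _ _ (fun=> 0) (fun t : R => Num.min t 1)); first exact: cvg_cst.
    apply: (@continuous_min _ _ id (fun=> 1)); first exact: cvg_id.
    exact: cvg_cst.
  have /Hk/derivable1_diffP := clamp01 t.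
  exact: differentiable_continuous.
have intf : lebesgue_measure.-integrable `[-1, 2]%classic (EFin \o f).
  apply: continuous_compact_integrable; first exact: segment_compact.
  exact: continuous_subspaceT.
pose F (x : R) : R := (\int[lebesgue_measure]_(t in `[(-1)%R, x]) f t)%R.
exists F => t t01.
have [D E] : derivable F t 1 /\ (F^`()%classic t = f t).
  apply: (@continuous_FTC1_closed R f (-1) t 2) => //; last exact: cf.
  - by case/andP: t01; lra.
  - by case/andP: t01; lra.
rewrite -[k t](_ : f t = _); last by rewrite /f /= clamp_id.
by rewrite -E derive1E; apply: DeriveDef.
Qed.

Definition primitive_on01 (K k : R -> C) := forall t : R, 0 <= t <= 1 -> rder K t (k t).

Definition derivable_on01 (k : R -> C) := forall t : R, 0 <= t <= 1 -> exists l, rder k t l.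

Lemma primitive_ex k : derivable_on01 k -> exists K, primitive_on01 K k.
Proof.
move=> H.
(* The imaginary part is written as the real part of [- 'i%C * z], so that [rder_Re] covers both
   components. *)
have ReIm (z : C) : z = (complex.Re z)%:C%C + 'i%C * (complex.Re (- 'i%C * z))%:C%C.
  by case: z => a b; apply/eqP; rewrite eq_complex /=; apply/andP; split; apply/eqP; ring.
have [A HA] : exists K : R -> R, forall t : R, 0 <= t <= 1 -> is_derive t (1 : R) K (complex.Re (k t)).
  by apply: real_primitive => t /H[l /rder_Re[]].
have [B HB] : exists K : R -> R, forall t : R, 0 <= t <= 1 -> is_derive t (1 : R) K (complex.Re (- 'i%C * k t)).
  by apply: real_primitive => t /H[l /(derZ (- 'i%C))/rder_Re[]].
exists (fun t => (A t)%:C%C + 'i%C * (B t)%:C%C) => t t01.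
rewrite (ReIm (k t)); apply: derD; first exact/rder_real/HA.
by apply: derZ; apply/rder_real/HB.
Qed.

Lemma primitive_uniq K L k : primitive_on01 K k -> primitive_on01 L k -> K 1 - K 0 = L 1 - L 0.
Proof.
move=> HK HL; apply/eqP; rewrite -subr_eq0 -cmod_eq0 eq_le cmod_ge0 andbT.
have -> : K 1 - K 0 - (L 1 - L 0) = (K 1 - L 1) - (K 0 - L 0) by ring.
have := @rder_le R (fun t => K t - L t) (fun=> 0) (fun=> 0) (fun=> 0).
rewrite subr0; apply => // t t01; last by rewrite cmod0.
  by have := derB (HK t t01) (HL t t01); rewrite subrr.
Qed.

(** The integral over [0, 1] is the increment of any primitive, with default 0 if there is none;
    linearity and estimates thus reduce to rules for derivatives. *)
Definition cint (k : R -> C) : C :=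
  xget 0 [set v | exists2 K, primitive_on01 K k & v = K 1 - K 0]%classic.

Lemma cint_eq K k : primitive_on01 K k -> cint k = K 1 - K 0.
Proof.
move=> HK; rewrite /cint; case: xgetP => [v _ [L HL ->]|/(_ (K 1 - K 0))].
  exact: primitive_uniq HL HK.
by case; exists K.
Qed.

Lemma cintD k k' : derivable_on01 k -> derivable_on01 k' ->
  cint (fun t => k t + k' t) = cint k + cint k'.
Proof.
move=> /primitive_ex[K HK] /primitive_ex[L HL].
rewrite (cint_eq HK) (cint_eq HL) (@cint_eq (fun t => K t + L t)); first by ring.
by move=> t t01; apply: derD; [exact: HK|exact: HL].
Qed.

Lemma cintZ c k : derivable_on01 k -> cint (fun t => c * k t) = c * cint k.
Proof.
move=> /primitive_ex[K HK].
rewrite (cint_eq HK) (@cint_eq (fun t => c * K t)); first by ring.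
by move=> t t01; apply: derZ; exact: HK.
Qed.

Lemma cint_cst c : cint (fun=> c) = c.
Proof.
rewrite (@cint_eq (fun t => c * t%:C%C)); first by rewrite mulr1 mulr0 subr0.
by move=> t t01; have := derZ c (rder_id t); rewrite mulr1.
Qed.

Lemma derivableD01 k k' : derivable_on01 k -> derivable_on01 k' ->
  derivable_on01 (fun t => k t + k' t).
Proof. by move=> H H' t t01; have [l] := H t t01; have [m] := H' t t01; exists (l + m); apply: derD. Qed.

Lemma derivableM01 k k' : derivable_on01 k -> derivable_on01 k' ->
  derivable_on01 (fun t => k t * k' t).
Proof.
move=> H H' t t01; have [l L] := H t t01; have [m M] := H' t t01.
by exists (l * k' t + k t * m); apply: derM.
Qed.

Lemma derivable_cst01 c : derivable_on01 (fun=> c).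
Proof. by move=> t _; exists 0; apply: der_cst. Qed.

Lemma derivable_comp01 (f : C -> C) k : derivable_on01 k ->
  (forall t : R, 0 <= t <= 1 -> exists l, cder f (k t) l) -> derivable_on01 (fun t => f (k t)).
Proof.
move=> H Hf t t01; have [l L] := H t t01; have [m M] := Hf t t01.
by exists (m * l); apply: der_comp.
Qed.

Lemma cintB k k' : derivable_on01 k -> derivable_on01 k' ->
  cint (fun t => k t - k' t) = cint k - cint k'.
Proof.
move=> H H'; rewrite -mulN1r -cintZ// -cintD//.
  by congr cint; apply/funext => t; rewrite mulN1r.
by apply: derivableM01 => //; apply: derivable_cst01.
Qed.

Lemma cint_le k (M : R) : derivable_on01 k -> (forall t : R, 0 <= t <= 1 -> cmod (k t) <= M) ->
  cmod (cint k) <= M.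
Proof.
move=> /primitive_ex[K HK] HM; rewrite (cint_eq HK).
have := @rder_le R K k (fun t => M * t) (fun=> M) HK.
rewrite mulr1 mulr0 subr0; apply => // t t01.
rewrite -[X in is_derive _ _ _ X]mulr1; apply: (@is_deriveZ _ _ _ id).
Qed.

Lemma rder_affine (K : R -> C) (a b t : R) l :
  rder K (a * t + b) l -> rder (fun s => K (a * s + b)) t (a%:C%C * l).
Proof.
move=> H e e0; have A0 : 0 < `|a| + 1 by rewrite ltr_wpDl.
have [d d0 {}H] := H _ (divr_gt0 e0 A0).
exists (d / (`|a| + 1)); first by rewrite divr_gt0.
move=> h; rewrite cmod_real => hd.
have ah : `|a * h| <= `|h| * (`|a| + 1) by rewrite normrM mulrC ler_wpM2l// lerDl.
have := H (a * h); rewrite cmod_real.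
rewrite (_ : a * (t + h) + b = a * t + b + a * h); last by ring.
rewrite rmorphM /= mulrCA mulrA => H'.
apply: (le_trans (H' _)).
  by apply: (le_lt_trans ah); rewrite -ltr_pdivlMr.
apply: (le_trans (ler_wpM2l _ ah)); first by rewrite divr_ge0 ?ltW.
by rewrite mulrCA divfK ?gt_eqF// mulrC.
Qed.

End Primitive.

(** * Goursat's lemma and primitives *)

Section Goursat.
Variable R : realType.
Local Notation C := (R[i])^o.

Definition seg (a b : C) (t : R) : C := a + t%:C%C * (b - a).

Lemma rder_seg a b t : rder (seg a b) t (b - a).
Proof.
have := derD (der_cst _ a t) (derM (rder_id t) (der_cst _ (b - a) t)).
by rewrite mul1r mulr0 addr0 add0r.
Qed.

Lemma seg_ball c (r : R) a b (t : R) : cmod (a - c) <= r -> cmod (b - c) <= r ->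
  0 <= t <= 1 -> cmod (seg a b t - c) <= r.
Proof.
move=> ar br /andP[t0 t1].
have -> : seg a b t - c = (1 - t)%:C%C * (a - c) + t%:C%C * (b - c).
  by rewrite /seg rmorphB /=; ring.
apply: (le_trans (cmodD _ _)); rewrite !cmodM !cmod_real !ger0_norm ?subr_ge0//.
have -> : r = (1 - t) * r + t * r by ring.
by apply: lerD; apply: ler_wpM2l; rewrite ?subr_ge0.
Qed.

Lemma seg_disc a b (t : R) : disc a -> disc b -> 0 <= t <= 1 -> disc (seg a b t).
Proof.
rewrite /disc /= => a1 b1 t01.
have := @seg_ball 0 (Num.max (cmod a) (cmod b)) a b t.
rewrite !subr0 => H; apply: (le_lt_trans (H _ _ t01)).
- by rewrite le_max lexx.
- by rewrite le_max lexx orbT.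
- by rewrite gt_max a1.
Qed.

Lemma cmod_seg a b (t : R) : 0 <= t <= 1 -> cmod (seg a b t - a) <= cmod (b - a).
Proof.
by move=> t01; apply: seg_ball => //; rewrite subrr cmod0 cmod_ge0.
Qed.

Definition cderivable_on (D : C -> Prop) (f : C -> C) := forall z, D z -> exists l, cder f z l.

Definition lint (f : C -> C) a b := cint (fun t => f (seg a b t)) * (b - a).

Lemma derivable_seg D f a b : cderivable_on D f -> (forall t : R, 0 <= t <= 1 -> D (seg a b t)) ->
  derivable_on01 (fun t => f (seg a b t)).
Proof.
move=> Hf HD; apply: derivable_comp01 => t t01; first by exists (b - a); apply: rder_seg.
exact/Hf/HD.
Qed.

Lemma lint_FTC (F f : C -> C) a b :
  (forall t : R, 0 <= t <= 1 -> cder F (seg a b t) (f (seg a b t))) ->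
  derivable_on01 (fun t => f (seg a b t)) ->
  lint f a b = F b - F a.
Proof.
move=> H D; rewrite /lint mulrC -cintZ// (@cint_eq _ (fun t => F (seg a b t))).
  by rewrite /seg mul1r mul0r addr0 [a + _]addrC subrK.
by move=> t t01; rewrite mulrC; apply: der_comp; [exact: rder_seg|exact: H].
Qed.

Lemma lint_rev f a b : derivable_on01 (fun t => f (seg a b t)) -> lint f b a = - lint f a b.
Proof.
move=> /primitive_ex[K HK].
rewrite /lint (cint_eq HK) (@cint_eq _ (fun t => - K ((-1) * t + 1))).
  by rewrite mulr0 add0r mulN1r addNr; ring.
move=> t t01; have t01' : 0 <= -1 * t + 1 <= 1 by lra.
have H := derN (rder_affine (HK _ t01')).
suff E : - ((-1)%:C%C * f (seg a b (-1 * t + 1))) = f (seg b a t) by rewrite -E; exact: H.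
have -> : seg a b (-1 * t + 1) = seg b a t.
  by rewrite /seg rmorphD rmorphM rmorphN rmorph1 /=; ring.
by rewrite rmorphN rmorph1 mulN1r opprK.
Qed.

Definition mid (a b : C) : C := (a + b) / 2.

(** The halves are [seg a b] run at half speed, so [2 * K (t / 2)] and [2 * K ((t + 1) / 2)] are
    primitives of the integrands on them. *)
Lemma lint_mid f a b : derivable_on01 (fun t => f (seg a b t)) ->
  lint f a b = lint f a (mid a b) + lint f (mid a b) b.
Proof.
move=> /primitive_ex[K HK].
have two0 : (2 : C) != 0 by rewrite -(rmorph_nat (@real_complex R)) -cmod_gt0 cmod_real normr_gt0 pnatr_eq0.
have hE : (2^-1 : R)%:C%C = 2^-1 :> C by rewrite fmorphV rmorph_nat.
rewrite /lint (cint_eq HK) (@cint_eq _ (fun t => 2 * K (2^-1 * t + 0))).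
  rewrite (@cint_eq _ (fun t => 2 * K (2^-1 * t + 2^-1))).
    rewrite !mulr1 !mulr0 !add0r !addr0.
    have -> : 2^-1 + 2^-1 = 1 :> R by lra.
    by rewrite /mid; field.
  move=> t t01; have t01' : 0 <= 2^-1 * t + 2^-1 <= 1 by lra.
  have := derZ 2 (rder_affine (HK _ t01')); rewrite hE mulVKf//.
  by congr (rder _ _ (f _)); rewrite /seg /mid rmorphD rmorphM /= hE; field.
move=> t t01; have t01' : 0 <= 2^-1 * t + 0 <= 1 by lra.
have := derZ 2 (rder_affine (HK _ t01')); rewrite hE mulVKf//.
by congr (rder _ _ (f _)); rewrite /seg /mid rmorphD rmorphM rmorph0 /= hE; field.
Qed.

End Goursat.

Section GoursatTriangle.
Variable R : realType.
Local Notation C := (R[i])^o.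
Variable f : C -> C.
Hypothesis Hf : cderivable_on (@disc R) f.

Let two0 : (2 : C) != 0.
Proof. by rewrite -(rmorph_nat (@real_complex R)) -cmod_gt0 cmod_real normr_gt0 pnatr_eq0. Qed.

Let cmod_half (z : C) : cmod (z / 2) = cmod z / 2.
Proof. by rewrite cmodM cmodV -(rmorph_nat (@real_complex R)) cmod_real ger0_norm. Qed.

Let Ds a b : disc a -> disc b -> derivable_on01 (fun t => f (seg a b t)).
Proof. by move=> ad bd; apply: (derivable_seg Hf) => t; apply: seg_disc. Qed.

Definition boundary_int a b c := lint f a b + lint f b c + lint f c a.

(** Used with [r < 1], so that limits of vertices stay in the disc; [d] is the size that is halved
    at each bisection. *)
Definition small_triangle (r d : R) (T : C * C * C) :=
  let: (a, b, c) := T in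
  [/\ [/\ cmod a <= r, cmod b <= r & cmod c <= r],
      cmod (b - a) <= d, cmod (c - b) <= d & cmod (a - c) <= d].

Lemma mid_le (r : R) a b : cmod a <= r -> cmod b <= r -> cmod (mid a b) <= r.
Proof.
by move=> ar br; rewrite /mid cmod_half ler_pdivrMr//; apply: (le_trans (cmodD _ _)); lra.
Qed.

(** The midpoints cut the triangle into four. Inner sides are traversed in both directions and
    cancel, so one of the four boundary integrals carries at least a quarter of the original. The
    bound on [a' - a] makes the first vertices converge under iteration. *)
Lemma boundary_int_step (r d : R) a b c : r < 1 -> small_triangle r d (a, b, c) ->
  exists T : C * C * C, let: (a', b', c') := T in
  [/\ small_triangle r (d / 2) (a', b', c'), cmod (a' - a) <= d &
      cmod (boundary_int a b c) <= 4 * cmod (boundary_int a' b' c')].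
Proof.
move=> r1 [[ar br cr] ab bc ca].
have dsc z : cmod z <= r -> disc z by move=> zr; apply: le_lt_trans r1.
set p := mid a b; set q := mid b c; set s := mid c a.
have pr : cmod p <= r by apply: mid_le.
have qr : cmod q <= r by apply: mid_le.
have sr : cmod s <= r by apply: mid_le.
have d0 : 0 <= d by apply: le_trans ab; rewrite cmod_ge0.
have hf z w : cmod w <= d -> z = w / 2 \/ z = - (w / 2) -> cmod z <= d / 2.
  by move=> wd [] ->; rewrite ?cmodN cmod_half ler_wpM2r.
have hab : forall z, z = (b - a) / 2 \/ z = - ((b - a) / 2) -> cmod z <= d / 2 by move=> z; apply: hf.
have hbc : forall z, z = (c - b) / 2 \/ z = - ((c - b) / 2) -> cmod z <= d / 2 by move=> z; apply: hf.
have hca : forall z, z = (a - c) / 2 \/ z = - ((a - c) / 2) -> cmod z <= d / 2 by move=> z; apply: hf.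
have d2 : d / 2 <= d by lra.
have E : boundary_int a b c = boundary_int a p s + boundary_int p b q + boundary_int s q c
    + boundary_int p q s.
  rewrite /boundary_int (lint_mid (Ds (dsc _ ar) (dsc _ br))) (lint_mid (Ds (dsc _ br) (dsc _ cr)))
    (lint_mid (Ds (dsc _ cr) (dsc _ ar))) -/p -/q -/s.
  rewrite (lint_rev (Ds (dsc _ pr) (dsc _ qr))) (lint_rev (Ds (dsc _ qr) (dsc _ sr)))
    (lint_rev (Ds (dsc _ sr) (dsc _ pr))); ring.
have T1 : small_triangle r (d / 2) (a, p, s).
  by split; [split|apply: hab|apply: hbc|apply: hca]; rewrite // /p /s /mid; try (left; by field); right; by field.
have T2 : small_triangle r (d / 2) (p, b, q).
  by split; [split|apply: hab|apply: hbc|apply: hca]; rewrite // /p /q /mid; try (left; by field); right; by field.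
have T3 : small_triangle r (d / 2) (s, q, c).
  by split; [split|apply: hab|apply: hbc|apply: hca]; rewrite // /s /q /mid; try (left; by field); right; by field.
have T4 : small_triangle r (d / 2) (p, q, s).
  by split; [split|apply: hca|apply: hab|apply: hbc]; rewrite // /p /q /s /mid; try (left; by field); right; by field.
have pa : cmod (p - a) <= d by apply: le_trans d2; apply: hab; left; rewrite /p /mid; field.
have sa : cmod (s - a) <= d by apply: le_trans d2; apply: hca; right; rewrite /s /mid; field.
have aa : cmod (a - a) <= d by rewrite subrr cmod0.
have : cmod (boundary_int a b c) <= cmod (boundary_int a p s) + cmod (boundary_int p b q) +
    cmod (boundary_int s q c) + cmod (boundary_int p q s).
  by rewrite E; do 3![apply: (le_trans (cmodD _ _)); rewrite lerD2r].
set W := cmod (boundary_int a b c) => HW.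
have [h1|h1] := leP W (4 * cmod (boundary_int a p s)); first by exists (a, p, s).
have [h2|h2] := leP W (4 * cmod (boundary_int p b q)); first by exists (p, b, q).
have [h3|h3] := leP W (4 * cmod (boundary_int s q c)); first by exists (s, q, c).
by exists (p, q, s); split => //; lra.
Qed.

End GoursatTriangle.

Section PrimitiveDisc.
Variable R : realType.
Local Notation C := (R[i])^o.
Variable f : C -> C.
Hypothesis Hf : cderivable_on (@disc R) f.

Let Ds a b : disc a -> disc b -> derivable_on01 (fun t => f (seg a b t)).
Proof. by move=> ad bd; apply: (derivable_seg Hf) => t; apply: seg_disc. Qed.

(** [P] is a primitive of the affine approximation of [f] at [z], so only the approximation error
    gets integrated; around a triangle the increments of [P] cancel. *)
Lemma lint_sub_affine (z l : C) (P : C -> C) a b (e r : R) :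
  (forall x, cder P x (f z + (x - z) * l)) -> disc a -> disc b ->
  (forall t : R, 0 <= t <= 1 ->
     cmod (f (seg a b t) - f z - (seg a b t - z) * l) <= e * cmod (seg a b t - z)) ->
  0 <= e -> cmod (a - z) <= r -> cmod (b - z) <= r ->
  cmod (lint f a b - (P b - P a)) <= e * r * cmod (b - a).
Proof.
move=> Pp ad bd H e0 az bz.
pose p (x : C) := f z + (x - z) * l.
have pd : derivable_on01 (fun t => p (seg a b t)).
  apply: derivable_comp01 => t t01; first by exists (b - a); apply: rder_seg.
  have := derD (der_cst _ (f z) (seg a b t)) (derM (derB (cder_id (seg a b t)) (der_cst _ z _)) (der_cst _ l _)).
  by move=> h; eexists; exact: h.
rewrite -(lint_FTC (F := P) (f := p) (a := a) (b := b)) // /lint -mulrBl -cintB//; last exact: Ds.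
rewrite cmodM ler_wpM2r ?cmod_ge0// cint_le//.
  apply: derivableD01; first exact: Ds.
  rewrite (_ : (fun t => _) = (fun t => (-1) * p (seg a b t))); last by apply/funext => t; rewrite mulN1r.
  by apply: derivableM01 => //; apply: derivable_cst01.
move=> t t01; rewrite /p opprD addrA; apply: (le_trans (H t t01)).
by rewrite ler_wpM2l// seg_ball.
Qed.

(** The integral is at most [4 ^+ i] times that over the [i]-th triangle, of size [D / 2 ^+ i]. Near
    the limit point [z] the map [f] is affine up to [e] times the distance to [z], so this smaller
    integral is of order [e * (D / 2 ^+ i) ^+ 2] and the powers of 4 cancel. *)
Lemma boundary_int0 a b c : disc a -> disc b -> disc c -> boundary_int f a b c = 0.
Proof.
move=> ad bd cd.
pose r := Num.max (cmod a) (Num.max (cmod b) (cmod c)).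
have r1 : r < 1 by rewrite !gt_max; apply/and3P.
have ar : cmod a <= r by rewrite le_max lexx.
have br : cmod b <= r by rewrite !le_max lexx orbT.
have cr : cmod c <= r by rewrite !le_max lexx !orbT.
pose D := cmod (b - a) + cmod (c - b) + cmod (a - c) + 1.
have D0 : 0 < D by rewrite ltr_wpDl// !addr_ge0 ?cmod_ge0.
have S0 : small_triangle r D (a, b, c).
  have := cmod_ge0 (b - a); have := cmod_ge0 (c - b); have := cmod_ge0 (a - c).
  by rewrite /D => h1 h2 h3; split; [split| | |] => //; lra.
(* Choice is made on pairs of a stage and a triangle, so that the nested sequence [T] can be defined
   by plain recursion. *)
have [s Hs] : {s : nat * (C * C * C) -> C * C * C & forall x, small_triangle r (D / 2 ^+ x.1) x.2 ->
    [/\ small_triangle r (D / 2 ^+ x.1 / 2) (s x), cmod ((s x).1.1 - x.2.1.1) <= D / 2 ^+ x.1 &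
      cmod (boundary_int f x.2.1.1 x.2.1.2 x.2.2) <= 4 * cmod (boundary_int f (s x).1.1 (s x).1.2 (s x).2)]}.
  apply: (@boolp.choice _ _ (fun x y => small_triangle r (D / 2 ^+ x.1) x.2 ->
    [/\ small_triangle r (D / 2 ^+ x.1 / 2) y, cmod (y.1.1 - x.2.1.1) <= D / 2 ^+ x.1 &
      cmod (boundary_int f x.2.1.1 x.2.1.2 x.2.2) <= 4 * cmod (boundary_int f y.1.1 y.1.2 y.2)])).
  move=> [i [[a0 b0] c0]] /=; have [h|nh] := pselect (small_triangle r (D / 2 ^+ i) (a0, b0, c0)); last by exists (a0, b0, c0).
  by have [[[a1 b1] c1] h1] := boundary_int_step Hf r1 h; exists (a1, b1, c1).
pose T := fix T i := if i is j.+1 then s (j, T j) else (a, b, c).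
have TS i : small_triangle r (D / 2 ^+ i) (T i).
  elim: i => [|i IH] /=; first by rewrite expr0 divr1.
  by have [] := Hs (i, T i) IH; rewrite exprSr invfM mulrA.
have Tper i : cmod (boundary_int f a b c) <= 4 ^+ i * cmod (boundary_int f (T i).1.1 (T i).1.2 (T i).2).
  elim: i => [|i IH]; first by rewrite expr0 mul1r.
  have [_ _ h] := Hs (i, T i) (TS i).
  by apply: (le_trans IH); rewrite exprSr -mulrA ler_wpM2l ?exprn_ge0.
have Tstep i : cmod ((T i.+1).1.1 - (T i).1.1) <= D / 2 ^+ i.
  by have [] := Hs (i, T i) (TS i).
(* The telescoped bound with its negative term is what lets the induction on [j] close. *)
have Tadd i j : cmod ((T (i + j)%N).1.1 - (T i).1.1) <= 2 * (D / 2 ^+ i) - 2 * (D / 2 ^+ (i + j)).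
  elim: j => [|j IH]; first by rewrite addn0 !subrr cmod0.
  rewrite addnS; have := Tstep (i + j)%N; set A := T (i + j).+1; set B := T (i + j)%N.
  rewrite exprSr invfM.
  have -> : A.1.1 - (T i).1.1 = (A.1.1 - B.1.1) + (B.1.1 - (T i).1.1) by ring.
  by have := cmodD (A.1.1 - B.1.1) (B.1.1 - (T i).1.1); move: IH; rewrite -/B; lra.
have Tr i : cmod (T i).1.1 <= r.
  by have := TS i; case: (T i) => [[? ?] ?] [[]].
have [U HU] := free_ultra_ex.
have PU : ProperFilter U by case: HU => -[].
have [z Hz] := ultra_bounded HU Tr.
have zr : cmod z <= r := ucvg_le HU Hz Tr.
have Tz i : cmod ((T i).1.1 - z) <= 2 * (D / 2 ^+ i).
  apply/ler_addgt0Pr => e e0.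
  have [k [/= h1 h2]] := filter_ex (filterI (Hz e e0) (free_ultra_ge i HU)).
  have := Tadd i (k - i)%N; rewrite subnKC// => h3.
  have -> : (T i).1.1 - z = - ((T k).1.1 - (T i).1.1) + ((T k).1.1 - z) by ring.
  have := cmodD (- ((T k).1.1 - (T i).1.1)) ((T k).1.1 - z); rewrite cmodN.
  have : 0 <= D / 2 ^+ k by rewrite divr_ge0 ?exprn_ge0// ltW.
  lra.
have [l Hl] := Hf (le_lt_trans zr r1 : disc z).
apply/eqP; rewrite -cmod_eq0 eq_le cmod_ge0 andbT; apply/ler_addgt0Pr => e' e'0; rewrite add0r.
(* The 9 counts three sides, on each of which the distance to [z] is at most [3 * di]; [D ^+ 2] is
   [4 ^+ i * di ^+ 2]. *)
pose e := e' / (9 * D ^+ 2).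
have e0 : 0 < e by rewrite divr_gt0// mulr_gt0// exprn_gt0.
have [d d0 {}Hl] := Hl e e0.
have [i Hi] : exists i, 3 * (D / 2 ^+ i) < d.
  have D3 : 0 < d / (3 * D) by rewrite divr_gt0// mulr_gt0.
  have [i /= hi] := filter_ex (free_ultra_inv HU D3); exists i.
  have : (2 ^+ i)^-1 <= i.+1%:R^-1 :> R.
    by rewrite lef_pV2 ?posrE ?ltr0n ?exprn_gt0// -natrX ler_nat ltn_expl.
  move=> /le_lt_trans/(_ hi); rewrite ltr_pdivlMr ?mulr_gt0// => h.
  by have -> : 3 * (D / 2 ^+ i) = (2 ^+ i)^-1 * (3 * D) by ring.
have := TS i; have := Tz i; have := Tper i.
case: (T i) => [[a1 b1] c1] /=; set di := D / 2 ^+ i => hper az [[a1r b1r c1r] ab bc ca].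
have bz : cmod (b1 - z) <= 3 * di.
  have -> : b1 - z = (b1 - a1) + (a1 - z) by ring.
  by have := cmodD (b1 - a1) (a1 - z); lra.
have cz : cmod (c1 - z) <= 3 * di.
  have -> : c1 - z = - (a1 - c1) + (a1 - z) by ring.
  by have := cmodD (- (a1 - c1)) (a1 - z); rewrite cmodN; lra.
have di0 : 0 < di by rewrite divr_gt0// exprn_gt0.
have {}az : cmod (a1 - z) <= 3 * di by lra.
have dsc w : cmod w <= r -> disc w by move=> wr; apply: le_lt_trans r1.
have loc u v : cmod (u - z) <= 3 * di -> cmod (v - z) <= 3 * di -> forall t : R, 0 <= t <= 1 ->
     cmod (f (seg u v t) - f z - (seg u v t - z) * l) <= e * cmod (seg u v t - z).
  move=> uz vz t t01; have := Hl (seg u v t - z); rewrite [z + _]addrC subrK; apply.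
  by apply: le_lt_trans Hi; apply: seg_ball.
have e0' := ltW e0.
pose P x := f z * x + l / 2 * ((x - z) * (x - z)).
have Pp x : cder P x (f z + (x - z) * l).
  have h2 := derB (cder_id x) (der_cst _ z x).
  have := derD (derZ (f z) (cder_id x)) (derZ (l / 2) (derM h2 h2)).
  by congr (cder _ _ _); field.
have := lint_sub_affine Pp (dsc _ a1r) (dsc _ b1r) (loc _ _ az bz) e0' az bz.
have := lint_sub_affine Pp (dsc _ b1r) (dsc _ c1r) (loc _ _ bz cz) e0' bz cz.
have := lint_sub_affine Pp (dsc _ c1r) (dsc _ a1r) (loc _ _ cz az) e0' cz az.
set X := lint f c1 a1 - _; set Y := lint f b1 c1 - _; set Z := lint f a1 b1 - _.
move=> hX hY hZ.
have E : boundary_int f a1 b1 c1 = Z + Y + X by rewrite /boundary_int /X /Y /Z; ring.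
have h9 : cmod (boundary_int f a1 b1 c1) <= 9 * e * di ^+ 2.
  have ed : 0 <= e * (3 * di) by rewrite mulr_ge0// mulr_ge0// ltW.
  have := ler_wpM2l ed ab; have := ler_wpM2l ed bc; have := ler_wpM2l ed ca.
  have := cmodD (Z + Y) X; have := cmodD Z Y; rewrite E.
  have -> : 9 * e * di ^+ 2 = e * (3 * di) * di + e * (3 * di) * di + e * (3 * di) * di by ring.
  lra.
apply: (le_trans hper); apply: (@le_trans _ _ (4 ^+ i * (9 * e * di ^+ 2))).
  by rewrite ler_wpM2l ?exprn_ge0.
rewrite /di /e expr_div_n -exprM mulnC exprM.
have -> : 2 ^+ 2 = 4 :> R by ring.
rewrite le_eqVlt; apply/orP; left; apply/eqP; field.
by rewrite !lt0r_neq0 ?exprn_gt0.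
Qed.

Lemma primitive_disc : exists F : C -> C, F 0 = 0 /\ forall z, disc z -> cder F z (f z).
Proof.
have d0 : disc (0 : C) by rewrite /disc /= cmod0.
(* Integration along the radius. The vanishing integral over the triangle 0, [z], [z + h] turns the
   increment into an integral over the segment from [z] to [z + h], on which [f] is within [e] of
   [f z]. *)
exists (fun z => lint f 0 z); split; first by rewrite /lint subrr mulr0.
move=> z zd e e0.
have [l L] := Hf zd.
have [d d0' H] := der_lip L.
pose A := 1 + cmod l.
have A0 : 0 < A by rewrite ltr_pwDl ?cmod_ge0.
exists (Num.min (1 - cmod z) (Num.min d (e / A))).
  by rewrite !lt_min subr_gt0 zd d0' divr_gt0.
move=> h; rewrite !lt_min => /and3P[h1 h2 h3].
have zhd : disc (z + h) by rewrite /disc /=; have := cmodD z h; lra.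
have : boundary_int f 0 z (z + h) = 0 by apply: boundary_int0.
rewrite /boundary_int (lint_rev (Ds d0 zhd)) => E.
have -> : lint f 0 (z + h) - lint f 0 z = lint f z (z + h).
  by apply/eqP; rewrite -subr_eq0 -oppr_eq0; apply/eqP; rewrite -[RHS]E; ring.
rewrite /lint addrAC subrr add0r mulrC -mulrBr cmodM mulrC ler_wpM2r ?cmod_ge0//.
rewrite -[X in _ - X](cint_cst (f z)) -cintB//; [|exact: Ds|exact: derivable_cst01].
apply: cint_le.
  by apply: derivableD01; [exact: Ds|exact: derivable_cst01].
have zhE : z + h - z = h by ring.
move=> t t01; have := cmod_seg z (z + h) t01; rewrite zhE => hs.
have := H (seg z (z + h) t - z); rewrite [z + (_ - z)]addrC subrK => /(_ (le_lt_trans hs h2)).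
move=> /le_trans; apply; rewrite -/A mulrC -ler_pdivlMr//.
by apply: le_trans hs _; apply: ltW.
Qed.

End PrimitiveDisc.

(** * Cauchy's formula and estimates *)

Section Cauchy.
Variable R : realType.
Local Notation C := (R[i])^o.

(** The circle e^(2 pi i t), parametrised over [0, 1] so that [cint] yields means directly. *)
Definition circ (t : R) : C := (cos (2 * pi * t) +i* sin (2 * pi * t))%C.

Definition two_pi_i : C := 'i%C * (2 * pi : R)%:C%C.

Lemma circE t : circ t = (cos (2 * pi * t))%:C%C + 'i%C * (sin (2 * pi * t))%:C%C.
Proof. by apply/eqP; rewrite eq_complex /circ /=; apply/andP; split; apply/eqP; ring. Qed.

Lemma two_pi_i_neq0 : two_pi_i != 0.
Proof.
rewrite /two_pi_i eq_complex /= negb_and; apply/orP; right.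
by rewrite mul0r mul1r add0r mulf_neq0// gt_eqF// pi_gt0.
Qed.

Lemma cmod_circ t : cmod (circ t) = 1.
Proof. by rewrite /cmod /= cos2Dsin2 sqrtr1. Qed.

Lemma circ_neq0 t : circ t != 0.
Proof. by rewrite -cmod_gt0 cmod_circ. Qed.

Lemma circ0 : circ 0 = 1.
Proof. by apply/eqP; rewrite eq_complex /circ /= mulr0 cos0 sin0 !eqxx. Qed.

Lemma circ1 : circ 1 = 1.
Proof. by apply/eqP; rewrite eq_complex /circ /= mulr1 mulr_natl cos2pi sin2pi !eqxx. Qed.

Lemma rder_circ t : rder circ t (two_pi_i * circ t).
Proof.
have D1 : is_derive t (1 : R) (fun s => 2 * pi * s) (2 * pi).
  by rewrite -[X in is_derive _ _ _ X]mulr1; apply: (@is_deriveZ _ _ _ id).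
have dc : is_derive t (1 : R) (fun s => cos (2 * pi * s)) (- sin (2 * pi * t) * (2 * pi)).
  exact: (@is_derive1_comp _ cos (fun s => 2 * pi * s) _ _ _ (is_derive_cos _) D1).
have ds : is_derive t (1 : R) (fun s => sin (2 * pi * s)) (cos (2 * pi * t) * (2 * pi)).
  exact: (@is_derive1_comp _ sin (fun s => 2 * pi * s) _ _ _ (is_derive_sin _) D1).
have := derD (proj1 (rder_real _ _ _) dc) (derZ 'i%C (proj1 (rder_real _ _ _) ds)).
congr (rder _ _ _); first by apply/funext => s; rewrite circE.
by apply/eqP; rewrite eq_complex /circ /two_pi_i /=; apply/andP; split; apply/eqP; ring.
Qed.

Lemma rder_circV (k : nat) t :
  rder (fun s => (circ s)^-1 ^+ k) t (- k%:R * two_pi_i * (circ t)^-1 ^+ k).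
Proof.
have h1 := der_comp (rder_circ t) (cder_inv (circ_neq0 t)).
have h2 := der_comp h1 (cder_exp (circ t)^-1 k).
suff -> : - k%:R * two_pi_i * (circ t)^-1 ^+ k = k%:R * (circ t)^-1 ^+ k.-1 *
  (- circ t ^- 2 * (two_pi_i * circ t)) by exact: h2.
have := circ_neq0 t; clear; case: k => [|k] c0; first by rewrite oppr0 !mul0r.
by rewrite [in LHS]exprS /=; move: (_ ^+ k) => x; field.
Qed.

Lemma derivable_circ01 : derivable_on01 circ.
Proof. by move=> t _; eexists; exact: rder_circ. Qed.

Lemma derivable_circV01 k : derivable_on01 (fun s => (circ s)^-1 ^+ k).
Proof. by move=> t _; eexists; exact: rder_circV. Qed.

Lemma lint_sub_cst (f : C -> C) a b c (M : R) : derivable_on01 (fun t => f (seg a b t)) ->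
  (forall t : R, 0 <= t <= 1 -> cmod (f (seg a b t) - c) <= M) ->
  cmod (lint f a b - (b - a) * c) <= M * cmod (b - a).
Proof.
move=> D H; rewrite /lint mulrC -mulrBr cmodM mulrC ler_wpM2r ?cmod_ge0//.
rewrite -[X in _ - X](cint_cst c) -cintB//; last exact: derivable_cst01.
by apply: cint_le => //; apply: derivableD01 => //; exact: derivable_cst01.
Qed.

Section WithPrimitive.
Variables F f : C -> C.
Hypothesis FF : forall z, disc z -> cder F z (f z).
Hypothesis Hf : cderivable_on (@disc R) f.

(** The remainder at [w] is the integral of [f - f w] over the segment from [w] to [w + h], and [f]
    oscillates little near each point; compactness makes the radius uniform. This uniformity is what
    differentiation under the integral sign requires. *)
Lemma cder_uniform (r e : R) : r < 1 -> 0 < e -> exists2 d : R, 0 < d &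
  forall z, cmod z <= r -> forall h, cmod h < d -> cmod (F (z + h) - F z - h * f z) <= e * cmod h.
Proof.
move=> r1 e0.
apply: (@closed_disc_uniform R r (fun z d => forall h, cmod h < d ->
   cmod (F (z + h) - F z - h * f z) <= e * cmod h)).
  by move=> z d d' H dd h hd; apply: H; apply: lt_le_trans dd.
move=> z zr; have z1 : cmod z < 1 := le_lt_trans zr r1.
have [l /der_lip[d1 d10 L]] := Hf (z1 : disc z).
pose A := 1 + cmod l; have A0 : 0 < A by rewrite ltr_pwDl ?cmod_ge0.
(* Half of the minimum: with [w] within [d] of [z] and [h] shorter than [d], the segment stays
   within [2 * d] of [z], where [f] deviates from [f z] by at most [e / 2]. *)
pose d := Num.min (1 - cmod z) (Num.min d1 (e / (2 * A))) / 2.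
have d0 : 0 < d.
  by rewrite divr_gt0// !lt_min subr_gt0 z1 d10 divr_gt0// mulr_gt0.
have [dz dd1 de] : [/\ 2 * d <= 1 - cmod z, 2 * d <= d1 & 2 * d <= e / (2 * A)].
  by rewrite mulrC divfK// !ge_min !lexx !orbT.
exists d => // w wr wz h hd.
have near z' : cmod (z' - z) < 2 * d -> disc z' /\ cmod (f z' - f z) <= e / 2.
  move=> hz; split; first by rewrite /disc /=; have := cmod_sub z' z; lra.
  have := L (z' - z); rewrite [z + _]addrC subrK => /(_ (lt_le_trans hz dd1))/le_trans; apply.
  rewrite -/A mulrC -ler_pdivlMr// -mulrA -invfM; apply: le_trans (ltW hz) _; exact: de.
have whz (t : R) : 0 <= t <= 1 -> cmod (seg w (w + h) t - z) < 2 * d.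
  move=> t01; have := cmod_seg w (w + h) t01; rewrite (_ : w + h - w = h); last by ring.
  have -> : seg w (w + h) t - z = (seg w (w + h) t - w) + (w - z) by ring.
  by have := cmodD (seg w (w + h) t - w) (w - z); lra.
have Dw : derivable_on01 (fun t => f (seg w (w + h) t)).
  by apply: (derivable_seg Hf) => t /whz/near[].
have wz2 : cmod (w - z) < 2 * d by lra.
have := @lint_sub_cst f w (w + h) (f w) e Dw.
rewrite (@lint_FTC _ F)//; last by move=> t /whz/near[/FF].
rewrite (_ : w + h - w = h); last by ring.
apply=> t /whz/near[_ h1]; have [_ h2] := near _ wz2.
have -> : f (seg w (w + h) t) - f w = (f (seg w (w + h) t) - f z) - (f w - f z) by ring.
by apply: (le_trans (cmodB _ _)); lra.
Qed.

(** Differentiation under the integral sign, from the uniform expansion of [F] with increment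
    [h * beta t]. With [beta] the circle the radius varies; with [beta = 1] the centre varies. *)
Lemma der_cint (alpha beta c : R -> C) (y : C) (r : R) : r < 1 ->
  derivable_on01 alpha -> derivable_on01 beta -> derivable_on01 c ->
  (forall t : R, 0 <= t <= 1 -> cmod (beta t) <= 1) ->
  (forall t : R, 0 <= t <= 1 -> cmod (c t) <= 1) ->
  (forall t : R, 0 <= t <= 1 -> cmod (alpha t + y * beta t) <= r) ->
  cder (fun x => cint (fun t => F (alpha t + x * beta t) * c t)) y
    (cint (fun t => f (alpha t + y * beta t) * (beta t * c t))).
Proof.
move=> r1 Da Db Dc b1 c1 hr e e0.
have [d d0 Hd] := cder_uniform r1 e0.
exists (Num.min d (1 - r)); first by rewrite lt_min d0 subr_gt0.
move=> h; rewrite lt_min => /andP[hd h1].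
have Dlin x : derivable_on01 (fun t => alpha t + x * beta t).
  by apply: derivableD01 => //; apply: derivableM01 => //; apply: derivable_cst01.
have bh t : 0 <= t <= 1 -> cmod (h * beta t) <= cmod h.
  by move=> t01; rewrite cmodM -[leRHS]mulr1 ler_wpM2l ?cmod_ge0// b1.
have Dg (G : C -> C) x : (cderivable_on (@disc R) G) ->
    (forall t : R, 0 <= t <= 1 -> disc (alpha t + x * beta t)) ->
    derivable_on01 (fun t => G (alpha t + x * beta t)).
  by move=> HG Hx; apply: derivable_comp01 => // t t01; apply/HG/Hx.
have HF : cderivable_on (@disc R) F by move=> z zd; exists (f z); apply: FF.
have yd t : 0 <= t <= 1 -> disc (alpha t + y * beta t).
  by move=> t01; apply: le_lt_trans r1; apply: hr.
have yhd t : 0 <= t <= 1 -> disc (alpha t + (y + h) * beta t).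
  move=> t01; rewrite /disc /= mulrDl addrA; apply: (le_lt_trans (cmodD _ _)).
  by have := hr t t01; have := bh t t01; lra.
have D1 : derivable_on01 (fun t => F (alpha t + (y + h) * beta t) * c t).
  by apply: derivableM01 => //; apply: Dg.
have D2 : derivable_on01 (fun t => F (alpha t + y * beta t) * c t).
  by apply: derivableM01 => //; apply: Dg.
have D3 : derivable_on01 (fun t => f (alpha t + y * beta t) * (beta t * c t)).
  by apply: derivableM01; [apply: Dg|apply: derivableM01].
have D4 : derivable_on01 (fun t => h * (f (alpha t + y * beta t) * (beta t * c t))).
  by apply: derivableM01 => //; apply: derivable_cst01.
have D5 : derivable_on01 (fun t => F (alpha t + (y + h) * beta t) * c t - F (alpha t + y * beta t) * c t).
  have -> : (fun t => F (alpha t + (y + h) * beta t) * c t - F (alpha t + y * beta t) * c t) =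
    (fun t => F (alpha t + (y + h) * beta t) * c t + (-1) * (F (alpha t + y * beta t) * c t)).
    by apply/funext => t; rewrite mulN1r.
  by apply: derivableD01 => //; apply: derivableM01 => //; apply: derivable_cst01.
rewrite -cintB// -cintZ// -cintB//; apply: cint_le.
  have -> : (fun t => F (alpha t + (y + h) * beta t) * c t - F (alpha t + y * beta t) * c t -
      h * (f (alpha t + y * beta t) * (beta t * c t))) =
    (fun t => (F (alpha t + (y + h) * beta t) * c t - F (alpha t + y * beta t) * c t) + (-1) *
      (h * (f (alpha t + y * beta t) * (beta t * c t)))).
    by apply/funext => t; rewrite mulN1r.
  by apply: derivableD01 => //; apply: derivableM01 => //; apply: derivable_cst01.
move=> t t01.
have := Hd _ (hr t t01) (h * beta t) (le_lt_trans (bh t t01) hd).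
rewrite -(addrA (alpha t)) -mulrDl => H.
have -> : F (alpha t + (y + h) * beta t) * c t - F (alpha t + y * beta t) * c t -
      h * (f (alpha t + y * beta t) * (beta t * c t)) =
   (F (alpha t + (y + h) * beta t) - F (alpha t + y * beta t) - h * beta t * f (alpha t + y * beta t)) * c t by ring.
rewrite cmodM -[leRHS]mulr1; apply: ler_pM; rewrite ?cmod_ge0// ?c1//.
by apply: le_trans H _; rewrite ler_wpM2l// ?bh// ltW.
Qed.

End WithPrimitive.
End Cauchy.

Section CauchyFormula.
Variable R : realType.
Local Notation C := (R[i])^o.

Let ball_disc (w z : C) (rho t : R) : cmod w + rho < 1 -> cmod z <= rho -> cmod (w + z * circ t) <= cmod w + rho.
Proof.
by move=> h1 h2; apply: (le_trans (cmodD _ _)); rewrite lerD2l cmodM cmod_circ mulr1.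
Qed.

Section WithPrimitive.
Variables F f : C -> C.
Hypothesis FF : forall z, disc z -> cder F z (f z).
Hypothesis Hf : cderivable_on (@disc R) f.
Variables (w : C) (rho : R).
Hypothesis (rho0 : 0 < rho) (wrho : cmod w + rho < 1).

Let wd z t : cmod z <= rho -> disc (w + z * circ t).
Proof. by move=> zr; apply: (le_lt_trans (ball_disc t wrho zr)). Qed.

Let Dw z : derivable_on01 (fun t => w + z * circ t).
Proof.
apply: derivableD01; first exact: derivable_cst01.
by apply: derivableM01; [exact: derivable_cst01|exact: derivable_circ01].
Qed.

(** For [z = rho > 0] this is rho^k times the Cauchy integral of G(x) (x - w)^(-k-1) divided by 2 pi
    i. The radius is complex so that [cder] applies to it. *)
Definition circ_mean (G : C -> C) (k : nat) (z : C) :=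
  cint (fun t => G (w + z * circ t) * (circ t)^-1 ^+ k).

Lemma cmod_circV (k : nat) t : cmod ((circ t)^-1 ^+ k : C) = 1.
Proof. by rewrite cmodX cmodV cmod_circ invr1 expr1n. Qed.

Lemma cder_circ_mean k z : cmod z <= rho -> cder (circ_mean F k.+1) z (circ_mean f k z).
Proof.
move=> zr; have := @der_cint R F f FF Hf (fun=> w) (@circ R) (fun t => (circ t)^-1 ^+ k.+1) z _ wrho
  (derivable_cst01 w) (@derivable_circ01 R) (@derivable_circV01 R k.+1).
have -> : (fun t => f (w + z * circ t) * (circ t * (circ t)^-1 ^+ k.+1)) =
  (fun t => f (w + z * circ t) * (circ t)^-1 ^+ k).
  by apply/funext => t; rewrite exprS mulVKf ?mulKf ?mulrA ?divff ?mul1r// ?circ_neq0.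
apply => t _; first by rewrite cmod_circ.
  by rewrite cmod_circV.
exact: ball_disc.
Qed.

(* The integrand [d/dt (F (w + z circ t) circ t ^ -k)] integrates to 0. *)
Lemma circ_mean_by_parts k z : cmod z <= rho ->
  z * circ_mean f k z = k.+1%:R * circ_mean F k.+1 z.
Proof.
move=> zr.
pose K t := F (w + z * circ t) * (circ t)^-1 ^+ k.+1.
have HK : primitive_on01 K (fun t => two_pi_i R * (z * (f (w + z * circ t) * (circ t)^-1 ^+ k)
    - k.+1%:R * (F (w + z * circ t) * (circ t)^-1 ^+ k.+1))).
  move=> t _.
  have h1 := derD (der_cst _ w t) (derZ z (rder_circ t)).
  have h2 := der_comp h1 (FF (wd t zr)).
  have h3 := derM h2 (rder_circV k.+1 t).
  suff <- : f (w + z * circ t) * (0 + z * (two_pi_i R * circ t)) * (circ t)^-1 ^+ k.+1 +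
      F (w + z * circ t) * (- k.+1%:R * two_pi_i R * (circ t)^-1 ^+ k.+1) =
    two_pi_i R * (z * (f (w + z * circ t) * (circ t)^-1 ^+ k)
    - k.+1%:R * (F (w + z * circ t) * (circ t)^-1 ^+ k.+1)) by exact: h3.
  rewrite !exprS; move: (circ_neq0 t) => c0; move: ((circ t)^-1 ^+ k) => q.
  by field.
have K0 : cint (fun t => two_pi_i R * (z * (f (w + z * circ t) * (circ t)^-1 ^+ k)
    - k.+1%:R * (F (w + z * circ t) * (circ t)^-1 ^+ k.+1))) = 0.
  by rewrite (cint_eq HK) /K circ0 circ1 subrr.
have D1 : derivable_on01 (fun t => f (w + z * circ t) * (circ t)^-1 ^+ k).
  apply: derivableM01; last exact: derivable_circV01.
  by apply: derivable_comp01; [exact: Dw|move=> t _; apply/Hf/wd].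
have D2 : derivable_on01 (fun t => F (w + z * circ t) * (circ t)^-1 ^+ k.+1).
  apply: derivableM01; last exact: derivable_circV01.
  by apply: derivable_comp01; [exact: Dw|move=> t _; eexists; apply/FF/wd].
have D1' : derivable_on01 (fun t => z * (f (w + z * circ t) * (circ t)^-1 ^+ k)).
  by apply: derivableM01 => //; exact: derivable_cst01.
have D2' : derivable_on01 (fun t => k.+1%:R * (F (w + z * circ t) * (circ t)^-1 ^+ k.+1)).
  by apply: derivableM01 => //; exact: derivable_cst01.
move: K0; rewrite cintZ; last first.
  have -> : (fun t => z * (f (w + z * circ t) * (circ t)^-1 ^+ k) -
      k.+1%:R * (F (w + z * circ t) * (circ t)^-1 ^+ k.+1)) =
     (fun t => z * (f (w + z * circ t) * (circ t)^-1 ^+ k) + (-1) * (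
      k.+1%:R * (F (w + z * circ t) * (circ t)^-1 ^+ k.+1))).
    by apply/funext => t; rewrite mulN1r.
  by apply: derivableD01 => //; apply: derivableM01 => //; exact: derivable_cst01.
move=> /eqP; rewrite mulf_eq0 (negbTE (two_pi_i_neq0 R)) /= cintB// !cintZ// subr_eq0 => /eqP.
by [].
Qed.

(* [circ_mean F 1 z / z] has derivative 0 by the previous two lemmas. *)
Lemma cauchy_formula : circ_mean F 1 rho%:C%C = rho%:C%C * f w.
Proof.
pose P := circ_mean F 1.
have Pz z : cmod z <= rho -> z * circ_mean f 0 z = P z.
  by move=> zr; rewrite circ_mean_by_parts// mul1r.
have d0r : cmod (0 : C) <= rho by rewrite cmod0 ltW.
have P0 : P 0 = 0 by rewrite -Pz// mul0r.
have A0 : circ_mean f 0 0 = f w.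
  rewrite /circ_mean -[RHS]cint_cst; congr cint; apply/funext => t.
  by rewrite mul0r addr0 expr0 mulr1.
have rC : rho%:C%C != 0 :> C by rewrite -cmod_gt0 cmod_real normr_gt0 gt_eqF.
(* Constancy along the real segment from [d] to [rho] suffices; it avoids 0, where the quotient is
   singular. *)
have ratio (d : R) : 0 < d -> d <= rho -> P rho%:C%C / rho%:C%C = P d%:C%C / d%:C%C.
  move=> dpos dr.
  have D t : 0 <= t <= 1 -> rder (fun t => P (seg d%:C%C rho%:C%C t) * (seg d%:C%C rho%:C%C t)^-1) t 0.
    move=> /andP[t0 t1]; set x := seg d%:C%C rho%:C%C t.
    have xE : x = (d + t * (rho - d))%:C%C by rewrite /x /seg rmorphD rmorphM rmorphB.
    have x0 : 0 < d + t * (rho - d) by rewrite ltr_pwDl// mulr_ge0// subr_ge0.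
    have xr : cmod x <= rho.
      rewrite xE cmod_real gtr0_norm//.
      by have := ler_wpM2r (_ : 0 <= rho - d) t1; rewrite subr_ge0 => /(_ dr); lra.
    have xn : x != 0 by rewrite -cmod_gt0 xE cmod_real normr_gt0 gt_eqF.
    have := der_comp (rder_seg d%:C%C rho%:C%C t) (derM (cder_circ_mean 0 xr) (cder_inv xn)).
    suff -> : circ_mean f 0 x * x^-1 + circ_mean F 1 x * - x ^- 2 = 0 by rewrite mul0r.
    by rewrite -[circ_mean F 1 x]Pz//; field.
  have := @primitive_uniq R (fun t => P (seg d%:C%C rho%:C%C t) * (seg d%:C%C rho%:C%C t)^-1) (fun=> 0) (fun=> 0) D
    (fun t _ => der_cst _ 0 t).
  rewrite subrr /seg mul1r mul0r addr0 [d%:C%C + _]addrC subrK => /eqP.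
  by rewrite subr_eq0 => /eqP.
suff <- : P rho%:C%C / rho%:C%C = f w by rewrite mulrC divfK.
apply/eqP; rewrite -subr_eq0 -cmod_eq0 eq_le cmod_ge0 andbT; apply/ler_addgt0Pr => e e0; rewrite add0r.
(* As [P 0 = 0], the quotient [P x / x] is the difference quotient of [P] at 0, whose limit is
   [circ_mean f 0 0 = f w]. *)
have [d d0 H] := cder_circ_mean 0 d0r e0.
pose x := Num.min (d / 2) rho.
have x0 : 0 < x by rewrite lt_min rho0 andbT divr_gt0.
have xd : x < d by rewrite gt_min; apply/orP; left; lra.
have xn : x%:C%C != 0 :> C by rewrite -cmod_gt0 cmod_real normr_gt0 gt_eqF.
rewrite (ratio x)//; last by rewrite ge_min lexx orbT.
have := H x%:C%C; rewrite -/P A0 P0 add0r subr0 cmod_real gtr0_norm// => /(_ xd).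
have -> : P x%:C%C - x%:C%C * f w = x%:C%C * (P x%:C%C / x%:C%C - f w) by field.
by rewrite cmodM cmod_real gtr0_norm// mulrC ler_pM2r.
Qed.

End WithPrimitive.

Section Derivative.
Variables f df : C -> C.
Hypothesis Hdf : forall z, disc z -> cder f z (df z).

Let Hf : cderivable_on (@disc R) f.
Proof. by move=> z zd; exists (df z); apply: Hdf. Qed.

(** Cauchy's formula for [f] holds at every centre near [w]; differentiating it in the centre under
    the integral sign and comparing derivatives gives the formula for [df]. *)
Lemma cauchy_derivative (w : C) (rho : R) : 0 < rho -> cmod w + rho < 1 ->
  rho%:C%C * df w = circ_mean w f 1 rho%:C%C.
Proof.
move=> rho0 wrho; have [F [_ HF]] := primitive_disc Hf.
have cr : cmod (rho%:C%C : C) <= rho by rewrite cmod_real gtr0_norm.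
have H1 := @der_cint R F f HF Hf (fun t => rho%:C%C * circ t) (fun=> 1) (fun t => (circ t)^-1 ^+ 1) w _ wrho
  _ (derivable_cst01 1) (@derivable_circV01 R 1).
have {}H1 : cder (fun x => cint (fun t => F (rho%:C%C * circ t + x * 1) * (circ t)^-1 ^+ 1)) w
    (circ_mean w f 1 rho%:C%C).
  have -> : circ_mean w f 1 rho%:C%C = cint (fun t => f (rho%:C%C * circ t + w * 1) * (1 * (circ t)^-1 ^+ 1)).
    by congr cint; apply/funext => t; rewrite mulr1 mul1r addrC.
  apply: H1 => [|t _|t _|t _].
  - by apply: derivableM01; [exact: derivable_cst01|exact: derivable_circ01].
  - by rewrite cmod1.
  - by rewrite cmod_circV.
  - by rewrite mulr1 addrC; apply: ball_disc.
apply: cder_uniq H1; apply: (@der_eq_near R C id (fun x => rho%:C%C * f x) _ _ _ (1 - cmod w - rho)) => //.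
- lra.
- move=> h /= hr; rewrite -(@cauchy_formula F f HF Hf (w + h) rho rho0); last by have := cmodD w h; lra.
  by congr cint; apply/funext => t; rewrite mulr1 addrC.
- by apply: derZ; apply: Hdf; rewrite /disc /=; lra.
Qed.

Lemma cauchy_estimate (w : C) (rho M : R) : 0 < rho -> cmod w + rho < 1 ->
  (forall z, cmod (z - w) <= rho -> cmod (f z) <= M) -> rho * cmod (df w) <= M.
Proof.
move=> rho0 wrho H.
have cr : cmod (rho%:C%C : C) <= rho by rewrite cmod_real gtr0_norm.
rewrite -{1}(gtr0_norm rho0) -cmod_real -cmodM cauchy_derivative//.
apply: cint_le => [|t _]; last first.
  rewrite cmodM cmod_circV mulr1; apply: H.
  by rewrite addrAC subrr add0r cmodM cmod_circ mulr1.
apply: derivableM01; last exact: derivable_circV01.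
apply: derivable_comp01 => [|t _]; last by apply: Hf; exact: (le_lt_trans (ball_disc t wrho cr)).
apply: derivableD01; first exact: derivable_cst01.
by apply: derivableM01; [exact: derivable_cst01|exact: derivable_circ01].
Qed.

(* [df] is locally a contour integral of [f], which can be differentiated
   once more under the integral sign. *)
Lemma derivative_cderivable : cderivable_on (@disc R) df.
Proof.
move=> w wd; have w1 : cmod w < 1 := wd.
pose rho := (1 - cmod w) / 2.
have rho0 : 0 < rho by rewrite divr_gt0// subr_gt0.
have wrho : cmod w + rho < 1 by rewrite /rho; lra.
have cr : cmod (rho%:C%C : C) <= rho by rewrite cmod_real gtr0_norm.
have rC : rho%:C%C != 0 :> C by rewrite -cmod_gt0 cmod_real normr_gt0 gt_eqF.
have [F [_ HF]] := primitive_disc Hf.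
have H1 := @der_cint R F f HF Hf (fun t => rho%:C%C * circ t) (fun=> 1) (fun t => (circ t)^-1 ^+ 2) w _ wrho
  _ (derivable_cst01 1) (@derivable_circV01 R 2).
have {}H1 : cder (fun x => cint (fun t => F (rho%:C%C * circ t + x * 1) * (circ t)^-1 ^+ 2)) w
    (cint (fun t => f (rho%:C%C * circ t + w * 1) * (1 * (circ t)^-1 ^+ 2))).
  apply: H1 => [|t _|t _|t _].
  - by apply: derivableM01; [exact: derivable_cst01|exact: derivable_circ01].
  - by rewrite cmod1.
  - by rewrite cmod_circV.
  - by rewrite mulr1 addrC; apply: ball_disc.
(* Cauchy's formula for [df] and one integration by parts give [df (w + h)] as [2 / rho ^+ 2] times
   the mean of [F] with exponent 2, a function of the centre to which [H1] applies. *)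
eexists; apply: (@der_eq_near R C id _ _ _ _ (1 - cmod w - rho)); last exact: (derZ (2 / rho%:C%C ^+ 2) H1).
- lra.
- move=> h /= hr; have whr : cmod (w + h) + rho < 1 by have := cmodD w h; lra.
  have E1 := cauchy_derivative rho0 whr.
  have E2 := @circ_mean_by_parts F f HF Hf (w + h) rho whr 1 rho%:C%C cr.
  have -> : cint (fun t => F (rho%:C%C * circ t + (w + h) * 1) * (circ t)^-1 ^+ 2) = circ_mean (w + h) F 2 rho%:C%C.
    by congr cint; apply/funext => t; rewrite mulr1 addrC.
  rewrite -mulrA mulrCA -E2 -E1; field; exact: rC.
- by [].
Qed.

End Derivative.
End CauchyFormula.

(** * Iterated derivatives and iterated primitives on the disc *)

Section IteratedDerivatives.
Variable R : realType.
Local Notation C := (R[i])^o.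
Implicit Types f g h : C -> C.

Lemma holo_cder f z : holo f -> disc z -> cder f z (derive1 f z).
Proof. by move=> H zd; apply: derivable_cder; apply: H. Qed.

Lemma cder_holo f : cderivable_on (@disc R) f -> holo f.
Proof. by move=> H z /H[l /cder_derive1[]]. Qed.

Lemma cder_derive1E f z l : cder f z l -> derive1 f z = l.
Proof. by move=> /cder_derive1[]. Qed.

Lemma holo_derive1 f : holo f -> holo (derive1 f).
Proof.
by move=> H; apply/cder_holo/(@derivative_cderivable R f) => z; apply: holo_cder.
Qed.

Lemma dernS k f : dern k.+1 f = derive1 (dern k f).
Proof. exact: derive1nS. Qed.

Lemma dernSr k f : dern k.+1 f = dern k (derive1 f).
Proof. exact: derive1Sn. Qed.

Lemma holo_dern k f : holo f -> holo (dern k f).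
Proof. by move=> H; elim: k => [//|k IH]; rewrite (dernS k f); apply: holo_derive1. Qed.

Lemma dern_cder k f z : holo f -> disc z -> cder (dern k f) z (dern k.+1 f z).
Proof.
move=> H zd.
rewrite (dernS k f).
exact: (holo_cder (@holo_dern k f H) zd).
Qed.

Lemma cder_eq_disc f g z l : (forall x, disc x -> f x = g x) -> disc z -> cder f z l -> cder g z l.
Proof.
move=> fg zd; apply: (@der_eq_near R C id f g z l (1 - cmod z)) => //; first by rewrite subr_gt0.
move=> h /= hz; rewrite fg// /disc /=; have := cmodD z h; lra.
Qed.

(** As the disc is open, a function known only on it has all its derivatives there given by a chain
    [G] of successive derivatives. This serves [Iop], which is specified on the disc only, and
    product formulas. *)
Lemma dern_jet (G : nat -> C -> C) : (forall k z, disc z -> cder (G k) z (G k.+1 z)) ->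
  forall k f z, (forall x, disc x -> f x = G 0 x) -> disc z -> dern k f z = G k z.
Proof.
move=> HG k f z fG; elim: k z => [|k IH] z zd; first exact: fG.
rewrite (dernS k f); apply: cder_derive1E; apply: (@cder_eq_disc (G k)) => //; last exact: HG.
by move=> x xd; rewrite IH.
Qed.

Lemma dern_eq k f g z : holo f -> (forall x, disc x -> g x = f x) -> disc z -> dern k g z = dern k f z.
Proof.
by move=> H fg zd; apply: (@dern_jet (fun j => dern j f)) => // j x xd; exact: (dern_cder j H xd).
Qed.

Lemma holoM f g : holo f -> holo g -> holo (fun z => f z * g z).
Proof.
move=> F G; apply: cder_holo => z zd; exists (derive1 f z * g z + f z * derive1 g z).
exact: (derM (holo_cder F zd) (holo_cder G zd)).
Qed.

Lemma holoB f g : holo f -> holo g -> holo (fun z => f z - g z).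
Proof.
move=> F G; apply: cder_holo => z zd; exists (derive1 f z - derive1 g z).
exact: (derB (holo_cder F zd) (holo_cder G zd)).
Qed.

Lemma holo_cst c : holo (fun=> c : C).
Proof. by apply: cder_holo => z zd; exists 0; apply: der_cst. Qed.

Lemma holo_sum (I : finType) (F : I -> C -> C) : (forall i, holo (F i)) -> holo (fun z => \sum_i F i z).
Proof.
move=> H; apply: cder_holo => z zd; exists (\sum_i derive1 (F i) z).
by apply: der_sum => i; exact: (holo_cder (H i) zd).
Qed.

Lemma dernB k f g z : holo f -> holo g -> disc z ->
  dern k (fun x => f x - g x) z = dern k f z - dern k g z.
Proof.
move=> F G zd; apply: (@dern_jet (fun j x => dern j f x - dern j g x)) => // j x xd.
exact: (derB (dern_cder j F xd) (dern_cder j G xd)).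
Qed.

(** Each order halves the radius: the bound of order [k] is used on discs of radius [rho / 2]
    centred within [rho / 2] of [w], and Cauchy's estimate then applies at [w]. *)
Lemma dern_estimate (k : nat) : exists2 B : R, 0 < B & forall f (w : C) (rho M : R), holo f ->
  0 < rho -> cmod w + rho < 1 -> (forall z, cmod (z - w) <= rho -> cmod (f z) <= M) ->
  rho ^+ k * cmod (dern k f w) <= B * M.
Proof.
elim: k => [|k [B B0 IH]].
  exists 1 => // f w rho M _ rho0 _ H; rewrite expr0 !mul1r; apply: H.
  by rewrite subrr cmod0 ltW.
exists (2 ^+ k.+1 * B); first by rewrite mulr_gt0// exprn_gt0.
move=> f w rho M Hf rho0 wrho H.
have r2 : 0 < rho / 2 by rewrite divr_gt0.
have := @cauchy_estimate R (dern k f) (dern k.+1 f) (fun z => @dern_cder k f z Hf) w (rho / 2)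
  (B * M / (rho / 2) ^+ k) r2.
have wr2 : cmod w + rho / 2 < 1 by lra.
move=> /(_ wr2) => E.
have -> : rho ^+ k.+1 * cmod (dern k.+1 f w) = 2 ^+ k.+1 * ((rho / 2) ^+ k * (rho / 2 * cmod (dern k.+1 f w))).
  by move: (cmod _) => x; rewrite expr_div_n !exprS; field; rewrite expf_neq0.
rewrite -[leRHS]mulrA ler_wpM2l ?exprn_ge0// mulrC -ler_pdivlMr ?exprn_gt0//; apply: E => z zw.
rewrite ler_pdivlMr ?exprn_gt0// mulrC; apply: (IH f z) => //.
  by have := cmod_sub z w; lra.
move=> x xz; apply: H; have -> : x - w = (x - z) + (z - w) by ring.
by have := cmodD (x - z) (z - w); lra.
Qed.

Lemma IopP f : holo f -> [/\ holo (Iop f), Iop f 0 = 0 & forall w, disc w -> derive1 (Iop f) w = f w].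
Proof.
move=> Hf; have : exists F : C -> C, holo F /\ F 0 = 0 /\ forall w, disc w -> derive1 F w = f w.
  have [F [F0 HF]] := @primitive_disc R f (fun z zd => ex_intro _ _ (holo_cder Hf zd)).
  exists F; split; first by apply: cder_holo => z /HF; exists (f z).
  by split=> // w /HF/cder_derive1E.
by move=> /(epsilon_spec (inhabits (fun _ : C => 0 : C))) [h1 [h2 h3]].
Qed.

Lemma holo_Iopn n f : holo f -> holo (Iopn n f).
Proof. by move=> Hf; elim: n => [//|n IH]; rewrite /Iopn /=; case: (IopP IH). Qed.

Lemma dern_Iopn n f z : holo f -> disc z -> dern n (Iopn n f) z = f z.
Proof.
move=> Hf zd; elim: n => [//|n IH]; rewrite (dernSr n) -[RHS]IH.
have [_ _ h] := IopP (@holo_Iopn n f Hf).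
by apply: (dern_eq n (@holo_Iopn n f Hf)) zd => x xd; exact: h.
Qed.

Lemma dern_Iopn0 n f j : holo f -> (j < n)%N -> dern j (Iopn n f) 0 = 0.
Proof.
move=> Hf; elim: n j => [|n IH] j jn; first by rewrite ltn0 in jn.
have [_ h0 h] := IopP (@holo_Iopn n f Hf).
case: j jn => [|j] jn; first exact: h0.
have d0 : disc (0 : C) by rewrite /disc /= cmod0.
rewrite (dernSr j); have -> := dern_eq j (@holo_Iopn n f Hf) h d0.
exact: IH.
Qed.

End IteratedDerivatives.

(** * Weighted suprema and Bloch norms *)

Section Weights.
Variable R : realType.
Local Notation C := (R[i])^o.
Implicit Types (h f : C -> C) (z : C).

Definition weight z : R := 1 - cmod z ^+ 2.

(** The bound is a parameter instead of a supremum, so that constants pass linearly from lemma to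
    lemma and no set has to be shown bounded. *)
Definition wbound (c M : R) h := forall z, disc z -> weight z `^ c * cmod (h z) <= M.

Lemma weight_ge z : disc z -> 1 - cmod z <= weight z.
Proof. by rewrite /disc /weight /= => z1; have := cmod_ge0 z; rewrite expr2; nra. Qed.

Lemma weight_gt0 z : disc z -> 0 < weight z.
Proof. by move=> zd; apply: (lt_le_trans _ (weight_ge zd)); rewrite subr_gt0. Qed.

Lemma weight_le z : weight z <= 2 * (1 - cmod z).
Proof. by rewrite /weight; have := sqr_ge0 (cmod z - 1); rewrite !expr2; lra. Qed.

Lemma weight_le1 z : weight z <= 1.
Proof. by rewrite /weight gerBl exprn_ge0 ?cmod_ge0. Qed.

Lemma wbound_ge0 c M h : wbound c M h -> 0 <= M.
Proof.
move=> H; have d0 : disc (0 : C) by rewrite /disc /= cmod0.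
by apply: le_trans (H 0 d0); rewrite mulr_ge0 ?powR_ge0 ?cmod_ge0.
Qed.

Lemma wbound_le c M M' h : M <= M' -> wbound c M h -> wbound c M' h.
Proof. by move=> MM H z zd; apply: le_trans MM; apply: H. Qed.

Lemma wbound_eq c M h f : (forall z, disc z -> f z = h z) -> wbound c M h -> wbound c M f.
Proof. by move=> E H z zd; rewrite E//; apply: H. Qed.

Lemma wboundD c M N h f : wbound c M h -> wbound c N f -> wbound c (M + N) (fun z => h z + f z).
Proof.
move=> H F z zd; apply: (le_trans _ (lerD (H z zd) (F z zd))).
by rewrite -mulrDr ler_wpM2l ?powR_ge0// cmodD.
Qed.

Lemma wboundN c M h : wbound c M h -> wbound c M (fun z => - h z).
Proof. by move=> H z zd; rewrite cmodN; apply: H. Qed.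

(** Cauchy's estimate on the disc whose radius is half of [1 - cmod z]; there the weight is at least
    [weight z / 4], which explains the factor. *)
Lemma wbound_derive c M h : 0 <= c -> holo h -> wbound c M h -> wbound (c + 1) (4 `^ (c + 1) * M) (derive1 h).
Proof.
move=> c0 Hh H z zd; have z1 : cmod z < 1 := zd.
pose rho := (1 - cmod z) / 2.
have rho0 : 0 < rho by rewrite divr_gt0// subr_gt0.
have w0 := weight_gt0 zd; have wle := weight_le z.
have w4 : 0 < weight z / 4 by rewrite divr_gt0.
have wr : weight z / 4 <= rho by rewrite /rho; lra.
have p0 : 0 < (weight z / 4) `^ c by rewrite powR_gt0.
have := @cauchy_estimate R h (derive1 h) (fun x xd => holo_cder Hh xd) z rho (M / (weight z / 4) `^ c) rho0.
have zr : cmod z + rho < 1 by rewrite /rho; lra.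
move=> /(_ zr) E.
have {}E : rho * cmod (derive1 h z) <= M / (weight z / 4) `^ c.
  apply: E => x xz; have xd : cmod x < 1 by have := cmod_sub x z; lra.
  rewrite ler_pdivlMr// mulrC; apply: le_trans (H x xd).
  apply: ler_wpM2r; first exact: cmod_ge0.
  apply: ge0_ler_powR => //; rewrite ?nnegrE; [exact: ltW|exact/ltW/weight_gt0|].
  by have := weight_ge xd; have := cmod_sub x z; rewrite /rho in wr xz *; lra.
have -> : weight z `^ (c + 1) = 4 `^ (c + 1) * ((weight z / 4) `^ c * (weight z / 4)).
  rewrite -{2}(powRr1 (ltW w4)) -powRD; last by rewrite (gt_eqF w4) implybT.
  by rewrite -powRM// ?ltW// mulrC divfK.
rewrite -mulrA ler_wpM2l ?powR_ge0// -mulrA mulrC -ler_pdivlMr//.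
by apply: le_trans E; rewrite ler_wpM2r ?cmod_ge0.
Qed.

Lemma wbound_dern k c : 0 <= c -> exists2 B : R, 0 < B &
  forall h M, holo h -> wbound c M h -> wbound (c + k%:R) (B * M) (dern k h).
Proof.
move=> c0; elim: k => [|k [B B0 IH]].
  by exists 1 => // h M _; rewrite addr0 mul1r.
exists (4 `^ (c + k%:R + 1) * B); first by rewrite mulr_gt0 ?powR_gt0.
move=> h M Hh H; rewrite -natr1 addrA -mulrA (dernS k h).
apply: wbound_derive; first by rewrite addr_ge0.
  exact: (@holo_dern _ k h Hh).
exact: IH.
Qed.

(** Along the radius the derivative is dominated by M |z| (1 - t|z|)^(-c), with primitive [phi]. As
    [c > 1], the value at [t = 1] is a negative power of [1 - cmod z], and
    [weight z <= 2 * (1 - cmod z)] costs the power of 2. *)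
Lemma wbound_primitive c M h : 1 < c -> holo h -> h 0 = 0 -> wbound c M (derive1 h) ->
  wbound (c - 1) (2 `^ (c - 1) / (c - 1) * M) h.
Proof.
move=> c1 Hh h0 H z zd; have z1 : cmod z < 1 := zd.
have M0 := wbound_ge0 H.
have c10 : 0 < c - 1 by rewrite subr_gt0.
have s0 := cmod_ge0 z.
pose phi (t : R) := M / (c - 1) * (1 - t * cmod z) `^ (1 - c).
have pos (t : R) : 0 <= t <= 1 -> 0 < 1 - t * cmod z.
  by move=> /andP[t0 t1]; nra.
have d0 : disc (0 : C) by rewrite /disc /= cmod0.
have Dphi (t : R) : 0 <= t <= 1 -> is_derive t (1 : R) phi (M * cmod z * (1 - t * cmod z) `^ (- c)).
  move=> t01; have D1 : is_derive t (1 : R) (fun s : R => 1 - s * cmod z) (- cmod z).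
    apply/rder_real.
    have := derB (der_cst _ (1 : C) t) (derM (rder_id t) (der_cst _ (cmod z)%:C%C t)).
    rewrite mulr0 addr0 mul1r sub0r -rmorphN; congr (rder _ _ _).
    by apply/funext => s; rewrite rmorphB rmorphM.
  have D2 := @is_derive1_comp _ (fun x : R => x `^ (1 - c)) (fun s : R => 1 - s * cmod z) _ _ _
     (is_derive1_powR (1 - c) (pos t t01)) D1.
  have := @is_deriveZ _ _ _ _ (M / (c - 1)) _ _ _ D2.
  have -> : 1 - c - 1 = - c by ring.
  have -> : (M / (c - 1)) *: ((1 - c) * (1 - t * cmod z) `^ (- c) * - cmod z) =
     M * cmod z * (1 - t * cmod z) `^ (- c).
    by rewrite /GRing.scale /=; field; rewrite gt_eqF.
  by [].
have := @rder_le R (fun t => h (seg 0 z t)) (fun t => derive1 h (seg 0 z t) * (z - 0)) phi _ _ Dphi.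
rewrite /seg mul1r mul0r add0r addr0 h0 !subr0.
move=> E; have {}E : cmod (h z) <= phi 1 - phi 0.
  apply: E => t t01.
    have := der_comp (rder_seg 0 z t) (holo_cder Hh (seg_disc d0 zd t01)).
    by rewrite /seg !subr0 add0r; congr (rder _ _ _); apply/funext => s; rewrite add0r.
  have := H _ (seg_disc d0 zd t01); rewrite /seg subr0 add0r => Ht.
  rewrite cmodM mulrC [M * _]mulrC -mulrA ler_wpM2l// powRN ler_pdivlMr ?powR_gt0 ?pos//.
  apply: le_trans Ht; rewrite mulrC ler_wpM2r ?cmod_ge0//.
  have td : disc (t%:C%C * z) by have := seg_disc d0 zd t01; rewrite /seg subr0 add0r.
  apply: ge0_ler_powR; rewrite ?nnegrE; [lra|exact/ltW/pos|exact/ltW/weight_gt0|].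
  apply: le_trans (weight_ge td); rewrite cmodM cmod_real ger0_norm//.
  by case/andP: t01.
have phi0 : 0 <= phi 0 by rewrite mulr_ge0 ?powR_ge0// divr_ge0// ltW.
have {}E : cmod (h z) <= M / (c - 1) / (1 - cmod z) `^ (c - 1).
  apply: (le_trans E); apply: (@le_trans _ _ (phi 1)); first by rewrite gerBl.
  by rewrite /phi mul1r -powRN opprB.
have p0 : 0 < (1 - cmod z) `^ (c - 1) by rewrite powR_gt0// subr_gt0.
apply: (@le_trans _ _ ((2 * (1 - cmod z)) `^ (c - 1) * (M / (c - 1) / (1 - cmod z) `^ (c - 1)))).
  apply: ler_pM; rewrite ?powR_ge0 ?cmod_ge0//.
  have := weight_gt0 zd; have := weight_le z => h1 h2.
  by apply: ge0_ler_powR; rewrite ?nnegrE; lra.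
rewrite powRM//; last by rewrite subr_ge0 ltW.
rewrite le_eqVlt; apply/orP; left; apply/eqP; field.
by rewrite !gt_eqF.
Qed.

(** Positivity of [b] keeps every exponent that gets integrated above 1, so the logarithmic case
    never occurs. *)
Lemma wbound_of_dern k b : 0 < b -> exists2 B : R, 0 < B &
  forall h M, holo h -> (forall j, (j < k)%N -> dern j h 0 = 0) ->
    wbound (b + k%:R) M (dern k h) -> wbound b (B * M) h.
Proof.
move=> b0; elim: k => [|k [B B0 IH]].
  by exists 1 => // h M _ _; rewrite addr0 mul1r.
pose c := b + k.+1%:R.
have c1 : 1 < c by rewrite /c -natr1 addrA ltrDr ltr_wpDr.
exists (B * (2 `^ (c - 1) / (c - 1))).
  by rewrite !mulr_gt0 ?powR_gt0// invr_gt0 subr_gt0.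
move=> h M Hh h0 H; rewrite -mulrA; apply: IH => // [j jk|]; first by apply: h0; apply: leqW.
have -> : b + k%:R = c - 1 by rewrite /c -natr1; ring.
apply: (wbound_primitive c1 (@holo_dern _ k h Hh)); first exact: h0.
by rewrite -(dernS k h).
Qed.

End Weights.

(** * Bounded and compact integral operators as weighted estimates *)

Section BlochNorm.
Variable R : realType.
Local Notation C := (R[i])^o.
Implicit Types (f h : C -> C).

Let disc0 : disc (0 : C).
Proof. by rewrite /disc /= cmod0. Qed.

Lemma bloch_sup_le a f M : wbound a M (derive1 f) -> bloch_sup a f <= M.
Proof.
move=> H; apply: ge_sup; last by move=> _ [z zd <-]; exact: H.
by eexists; exists (0 : C).
Qed.

Lemma wbound_bloch_sup a f : in_bloch a f -> wbound a (bloch_sup a f) (derive1 f).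
Proof.
move=> [_ [M HM]] z zd; apply: ub_le_sup; last by exists z.
by exists M => _ [x xd <-]; exact: HM.
Qed.

Lemma wbound_bloch_norm a f : in_bloch a f -> wbound a (bloch_norm a f) (derive1 f).
Proof. by move=> /wbound_bloch_sup; apply: wbound_le; rewrite lerDr cmod_ge0. Qed.

Lemma cmod0_le_bloch_norm a f : in_bloch a f -> cmod (f 0) <= bloch_norm a f.
Proof. by move=> /wbound_bloch_sup/wbound_ge0; rewrite /bloch_norm lerDl. Qed.

Lemma bloch_norm_ge0 a f : in_bloch a f -> 0 <= bloch_norm a f.
Proof. by move=> /cmod0_le_bloch_norm; apply: le_trans; apply: cmod_ge0. Qed.

Lemma bloch_norm_le a f M : wbound a M (derive1 f) -> bloch_norm a f <= cmod (f 0) + M.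
Proof. by move=> H; rewrite lerD2l bloch_sup_le. Qed.

Lemma in_blochB a f h : in_bloch a f -> in_bloch a h -> in_bloch a (fun z => f z - h z).
Proof.
move=> [Hf [M HM]] [Hh [N HN]]; split; first exact: holoB.
exists (M + N); apply: (wbound_eq (h := fun z => derive1 f z + - derive1 h z)).
  by move=> z zd; apply: cder_derive1E; apply: (derB (holo_cder Hf zd) (holo_cder Hh zd)).
exact: (wboundD HM (wboundN HN)).
Qed.

Section Operator.
Variables (alpha beta : R) (n : nat) (L : (C -> C) -> (C -> C)).
Hypothesis beta0 : 0 < beta.
Hypothesis L_holo : forall f, holo f -> holo (L f).

(** The seminorm already takes one derivative of [T f], so [L f] is reached after [n] more, each
    adding 1 to the exponent. *)
Let c : R := beta + n%:R.

Let T f := Iopn n.+1 (L f).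

Lemma wbound_up : exists2 B : R, 0 < B & forall f M, holo f ->
  wbound beta M (derive1 f) -> wbound c (B * M) (dern n.+1 f).
Proof.
have [B B0 H] := wbound_dern n (ltW beta0); exists B; first exact: B0.
move=> f M Hf HM.
by rewrite (dernSr n f); exact: (H _ _ (holo_derive1 Hf) HM).
Qed.

Lemma wbound_down : exists2 B : R, 0 < B & forall f M, holo f ->
  (forall j, (j < n.+1)%N -> dern j f 0 = 0) ->
  wbound c M (dern n.+1 f) -> wbound beta (B * M) (derive1 f).
Proof.
have [B B0 H] := wbound_of_dern n beta0; exists B; first exact: B0.
move=> f M Hf Hj HM.
apply: (H _ _ (holo_derive1 Hf)); last by rewrite -(dernSr n f).
by move=> j jn; rewrite -(dernSr j f); apply: Hj.
Qed.

Definition wbounded := exists K : R, forall f, in_bloch alpha f ->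
  wbound c (K * bloch_norm alpha f) (L f).

(** Limits are taken for [L (u j)] before integration, which frees the compactness argument from
    [Iopn]; the first conjunct corresponds to [maps_into]. *)
Definition wcompact :=
  (forall f, in_bloch alpha f -> exists M : R, wbound c M (L f)) /\
  forall u : nat -> C -> C, (forall j, in_bloch alpha (u j)) ->
    (exists M : R, forall j, bloch_norm alpha (u j) <= M) ->
    exists phi : nat -> nat, (forall j, (phi j < phi j.+1)%N) /\
    exists H : C -> C, [/\ holo H, exists M : R, wbound c M H &
      forall e : R, 0 < e -> exists N : nat, forall j, (N <= j)%N ->
        wbound c e (fun z => L (u (phi j)) z - H z)].

Lemma wbound_T f M : holo f -> wbound beta M (derive1 (T f)) ->
  forall B, (forall f M, holo f -> wbound beta M (derive1 f) -> wbound c (B * M) (dern n.+1 f)) ->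
  wbound c (B * M) (L f).
Proof.
move=> Hf HM B HB; apply: (wbound_eq (h := dern n.+1 (T f))).
  by move=> z zd; rewrite (dern_Iopn n.+1 (L_holo Hf) zd).
exact: (HB _ _ (@holo_Iopn _ n.+1 _ (L_holo Hf)) HM).
Qed.

Lemma bounded_opP : bounded_op alpha beta T <-> wbounded.
Proof.
have [B B0 HB] := wbound_up; have [D D0 HD] := wbound_down; split.
  move=> [Tinto [K HK]]; exists (B * K) => f Hf; rewrite -mulrA.
  apply: wbound_T HB; first by case: Hf.
  exact: wbound_le (HK f Hf) (wbound_bloch_norm (Tinto f Hf)).
move=> [K HK].
have key f : in_bloch alpha f -> wbound beta (D * (K * bloch_norm alpha f)) (derive1 (T f)).
  move=> Hf; have Lf := L_holo (proj1 Hf).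
  apply: HD; [exact: (@holo_Iopn _ n.+1 _ Lf)|by move=> j jn; exact: dern_Iopn0|].
  by apply: wbound_eq (HK f Hf) => z zd; exact: dern_Iopn.
split=> [f Hf|].
  split; first exact: (@holo_Iopn _ n.+1 _ (L_holo (proj1 Hf))).
  by eexists; exact: (key f Hf).
exists (D * K) => f Hf; apply: (le_trans (bloch_norm_le (key f Hf))).
have -> : T f 0 = 0 by exact: (@dern_Iopn0 _ n.+1 (L f) 0 (L_holo (proj1 Hf))).
by rewrite cmod0 add0r mulrA.
Qed.

(** Limits correspond by [dern n.+1] in one direction and [Iopn n.+1] in the other. In the latter
    both functions have vanishing derivatives at 0 up to order [n], so [wbound_down] applies to
    their difference. *)
Lemma compact_opP : compact_op alpha beta T <-> wcompact.
Proof.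
have [B B0 HB] := wbound_up; have [D D0 HD] := wbound_down; split.
  move=> [Tinto Hc]; split=> [f Hf|u Hu uM].
    exists (B * bloch_norm beta (T f)).
    apply: wbound_T HB; first by case: Hf.
    exact: (wbound_bloch_norm (Tinto f Hf)).
  have [phi [phiS [h [Hh cv]]]] := Hc u Hu uM.
  exists phi; split; first exact: phiS.
exists (dern n.+1 h); split.
  - exact: (@holo_dern _ n.+1 h (proj1 Hh)).
  - by eexists; exact: (HB _ _ (proj1 Hh) (wbound_bloch_norm Hh)).
  move=> e e0; have eB : 0 < e / B by rewrite divr_gt0.
  have [N _ HN] := (proj1 (cvgrPdist_lt _ _) cv) _ eB.
  exists N => j Nj; have := HN j Nj; rewrite /= sub0r normrN => /(le_lt_trans (ler_norm _)).
  set F := (fun z => T (u (phi j)) z - h z) => hF.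
  have FB : in_bloch beta F by exact: (in_blochB (Tinto _ (Hu _)) Hh).
  apply: (wbound_eq (h := dern n.+1 F)).
    move=> z zd; have Lh := L_holo (proj1 (Hu (phi j))).
    rewrite /F (dernB n.+1 (@holo_Iopn _ n.+1 _ Lh) (proj1 Hh) zd); congr (_ - _).
    by rewrite dern_Iopn.
  have := HB _ _ (proj1 FB) (wbound_bloch_norm FB); apply: wbound_le.
  by rewrite mulrC -ler_pdivlMr// ltW.
move=> [Linto Hc].
have key H M : holo H -> wbound c M H -> in_bloch beta (Iopn n.+1 H).
  move=> HH HM; split; first exact: (@holo_Iopn _ n.+1 _ HH).
  exists (D * M); apply: HD; [exact: (@holo_Iopn _ n.+1 _ HH)|by move=> j jn; exact: dern_Iopn0|].
  by apply: wbound_eq HM => z zd; exact: dern_Iopn.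
split=> [f Hf|u Hu uM].
  by have [M HM] := Linto f Hf; apply: key HM; exact: (L_holo (proj1 Hf)).
have [phi [phiS [H [HH [M HM] cv]]]] := Hc u Hu uM.
exists phi; split; first exact: phiS.
exists (Iopn n.+1 H); split; first exact: key HM.
apply/(proj2 (cvgrPdist_le _ _)) => e e0; have eD : 0 < e / D by rewrite divr_gt0.
have [N HN] := cv _ eD; exists N => // j /= Nj; rewrite sub0r normrN.
set F := (fun z => _); have Lh := L_holo (proj1 (Hu (phi j))).
have h1 : holo (T (u (phi j))) by exact: (@holo_Iopn _ n.+1 _ Lh).
have h2 : holo (Iopn n.+1 H) by exact: (@holo_Iopn _ n.+1 _ HH).
have FH : holo F by exact: holoB.
have FW : wbound beta (D * (e / D)) (derive1 F).
  apply: (HD _ _ FH) => [k kn|].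
    rewrite /F (dernB k h1 h2 disc0).
    by rewrite (dern_Iopn0 Lh kn) (dern_Iopn0 HH kn) subrr.
  apply: wbound_eq (HN j Nj) => z zd.
  by rewrite /F (dernB n.+1 h1 h2 zd) !dern_Iopn.
have FB : in_bloch beta F by split; last by eexists; exact: FW.
rewrite ger0_norm ?bloch_norm_ge0//; apply: (le_trans (bloch_norm_le FW)).
have -> : F 0 = 0.
  have e1 : T (u (phi j)) 0 = 0 by exact: (@dern_Iopn0 _ n.+1 _ 0 Lh).
  have e2 : Iopn n.+1 H 0 = 0 by exact: (@dern_Iopn0 _ n.+1 _ 0 HH).
  have -> : F 0 = T (u (phi j)) 0 - Iopn n.+1 H 0 by exact: erefl.
  by rewrite e1 e2 subrr.
by rewrite cmod0 add0r mulrC divfK// gt_eqF.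
Qed.

End Operator.
End BlochNorm.

(** * Montel's theorem *)

Section Montel.
Variable R : realType.
Local Notation C := (R[i])^o.

Lemma cder_lipschitz (F f : C -> C) (a b : C) (Q : R) :
  (forall t : R, 0 <= t <= 1 -> cder F (seg a b t) (f (seg a b t))) ->
  (forall t : R, 0 <= t <= 1 -> cmod (f (seg a b t)) <= Q) ->
  cmod (F b - F a) <= Q * cmod (b - a).
Proof.
move=> HF HQ.
have := @rder_le R (fun t => F (seg a b t)) (fun t => f (seg a b t) * (b - a))
  (fun t => (Q * cmod (b - a)) * t) (fun=> Q * cmod (b - a)).
rewrite /seg mul1r mul0r addr0 [a + _]addrC subrK mulr1 mulr0 subr0; apply=> t t01.
- exact: (der_comp (rder_seg a b t) (HF t t01)).
- by rewrite -[X in is_derive _ _ _ X]mulr1; apply: (@is_deriveZ _ _ _ id).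
- by rewrite cmodM ler_wpM2r ?cmod_ge0// HQ.
Qed.

Lemma wbound_local (c M r : R) (h : C -> C) z : 0 <= c -> r < 1 -> cmod z <= r -> wbound c M h ->
  cmod (h z) <= M / (1 - r) `^ c.
Proof.
move=> c0 r1 zr H; have zd : disc z by apply: le_lt_trans r1.
rewrite ler_pdivlMr ?powR_gt0 ?subr_gt0// mulrC; apply: le_trans (H z zd).
apply: ler_wpM2r; first exact: cmod_ge0.
apply: ge0_ler_powR => //; rewrite ?nnegrE; [by rewrite subr_ge0 ltW|exact/ltW/weight_gt0|].
by apply: le_trans (weight_ge zd); rewrite lerD2l lerN2.
Qed.

Variables (c M : R) (h : nat -> C -> C).
Hypotheses (c0 : 0 <= c) (h_holo : forall j, holo (h j)) (h_bound : forall j, wbound c M (h j)).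

Let ball_le_seg (r : R) (a b : C) (t : R) : cmod a <= r -> cmod b <= r -> 0 <= t <= 1 -> cmod (seg a b t) <= r.
Proof. by move=> ar br t01; have := @seg_ball R 0 r a b t; rewrite !subr0; apply. Qed.

(** Equicontinuity: the derivatives share one weighted bound, hence one constant on the smaller
    disc, which is convex. *)
Lemma uniform_lipschitz (r : R) : r < 1 -> exists2 Q : R, 0 <= Q & forall j a b,
  cmod a <= r -> cmod b <= r -> cmod (h j b - h j a) <= Q * cmod (b - a).
Proof.
move=> r1; have H' j := wbound_derive c0 (@h_holo j) (h_bound j).
exists (4 `^ (c + 1) * M / (1 - r) `^ (c + 1)).
  by rewrite divr_ge0 ?powR_ge0// (wbound_ge0 (H' 0)).
move=> j a b ar br; apply: (@cder_lipschitz (h j) (derive1 (h j))) => t t01.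
  by apply: holo_cder; [exact: h_holo|apply: le_lt_trans r1; apply: ball_le_seg].
by apply: wbound_local => //; [rewrite addr_ge0|apply: ball_le_seg].
Qed.

End Montel.

Section MontelLimit.
Variable R : realType.
Local Notation C := (R[i])^o.
Variables (U : set_system nat) (HU : free_ultra U).

Let PU : ProperFilter U. Proof. by case: HU => -[]. Qed.

Lemma ultra_pointwise (c M : R) (h : nat -> C -> C) : 0 <= c -> (forall j, wbound c M (h j)) ->
  exists v : C -> C, forall z, disc z -> ucvg U (fun j => h j z) (v z).
Proof.
move=> c0 H.
have H' (z : C) : exists l : C, disc z -> ucvg U (fun j => h j z) l.
  have [zd|nz] := pselect (disc z); last by exists 0.
  have [l Hl] := ultra_bounded HU (fun j => wbound_local c0 zd (lexx _) (H j)).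
  by exists l.
have [v Hv] := boolp.choice H'.
by exists v.
Qed.

Lemma ultra_limit_bound (c M : R) (h : nat -> C -> C) v : (forall j, wbound c M (h j)) ->
  (forall z, disc z -> ucvg U (fun j => h j z) (v z)) -> wbound c M v.
Proof.
move=> H Hv z zd; have w0 : 0 < weight z `^ c by rewrite powR_gt0 ?weight_gt0.
rewrite mulrC -ler_pdivlMr//; apply: (ucvg_le HU (Hv z zd)) => j.
by rewrite ler_pdivlMr// mulrC; exact: H.
Qed.

(** The derivatives have a pointwise limit [v1] as well, and their common Lipschitz constant bounds
    the Taylor remainders by [Q * cmod k * cmod k] for all [j]; this inequality passes to the
    limit. *)
Lemma ultra_limit_holo (c M : R) (h : nat -> C -> C) v : 0 <= c -> (forall j, holo (h j)) ->
  (forall j, wbound c M (h j)) ->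
  (forall z, disc z -> ucvg U (fun j => h j z) (v z)) -> holo v.
Proof.
move=> c0 Hh H Hv.
have H1 j := wbound_derive c0 (@Hh j) (H j).
have c1 : 0 <= c + 1 by rewrite addr_ge0.
have Hh1 j : holo (derive1 (h j)) by exact: holo_derive1.
have [v1 Hv1] := ultra_pointwise c1 H1.
apply: cder_holo => z zd; exists (v1 z).
have z1 : cmod z < 1 := zd.
pose r := (1 + cmod z) / 2.
have r1 : r < 1 by rewrite /r; lra.
have zr : cmod z <= r by rewrite /r; lra.
have [Q Q0 HQ] := uniform_lipschitz c1 Hh1 H1 r1.
have rz0 : 0 < r - cmod z by rewrite /r; lra.
have taylor j k : cmod k < r - cmod z ->
    cmod (h j (z + k) - h j z - k * derive1 (h j) z) <= Q * cmod k * cmod k.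
  move=> kr; have zkr : cmod (z + k) <= r by have := cmodD z k; lra.
  have zk : z + k - z = k by ring.
  have sr t : 0 <= t <= 1 -> cmod (seg z (z + k) t) <= r.
    by move=> t01; have := @seg_ball R 0 r z (z + k) t; rewrite !subr0; apply.
  have sd t : 0 <= t <= 1 -> disc (seg z (z + k) t).
    by move=> /sr; rewrite /disc /= => /le_lt_trans; apply.
  have D : derivable_on01 (fun t => derive1 (h j) (seg z (z + k) t)).
    apply: (@derivable_seg R (@disc R)); last exact: sd.
    by move=> x xd; eexists; exact: (holo_cder (Hh1 j) xd).
  have := @lint_sub_cst R (derive1 (h j)) z (z + k) (derive1 (h j) z) (Q * cmod k) D.
  rewrite (@lint_FTC _ (h j))//; last by move=> t /sd; exact: (holo_cder (Hh j)).
  rewrite zk; apply=> t t01; apply: (le_trans (HQ j _ _ zr (sr t t01))).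
  by rewrite ler_wpM2l//; have := cmod_seg z (z + k) t01; rewrite zk.
move=> e e0; have Q1 : 0 < Q + 1 by rewrite ltr_wpDl.
exists (Num.min (r - cmod z) (e / (Q + 1))); first by rewrite lt_min rz0 divr_gt0.
move=> k; rewrite lt_min => /andP[kr ke].
have zkd : disc (z + k) by rewrite /disc /=; have := cmodD z k; lra.
apply: (@le_trans _ _ (Q * cmod k * cmod k)).
  apply: (ucvg_le HU (ucvgB HU (ucvgB HU (Hv _ zkd) (Hv _ zd)) (ucvgZ HU k (Hv1 _ zd)))) => j.
  exact: taylor.
apply: ler_wpM2r; first exact: cmod_ge0.
move: ke; rewrite ltr_pdivlMr// => ke; have := cmod_ge0 k; lra.
Qed.

(** Otherwise [U]-almost every [h j] is off by more than [e] at some point [zz j]; at the limit [l]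
    of these points the common Lipschitz constant contradicts pointwise convergence, with thirds of
    [e]. *)
Lemma ultra_limit_uniform (c M r e : R) (h : nat -> C -> C) v : 0 <= c -> (forall j, holo (h j)) ->
  (forall j, wbound c M (h j)) ->
  (forall z, disc z -> ucvg U (fun j => h j z) (v z)) -> r < 1 -> 0 < e ->
  U [set j | forall z, cmod z <= r -> cmod (h j z - v z) <= e]%classic.
Proof.
move=> c0 Hh H Hv r1 e0.
have dsc z : cmod z <= r -> disc z by move=> zr; apply: le_lt_trans r1.
have [Q Q0 HQ] := uniform_lipschitz c0 Hh H r1.
have vQ a b : cmod a <= r -> cmod b <= r -> cmod (v b - v a) <= Q * cmod (b - a).
  move=> ar br; apply: (ucvg_le HU (ucvgB HU (Hv _ (dsc _ br)) (Hv _ (dsc _ ar)))) => j.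
  exact: HQ.
have UU : UltraFilter U by case: HU.
have [//|A] := in_ultra_setVsetC [set j | forall z, cmod z <= r -> cmod (h j z - v z) <= e]%classic UU.
(* The radius may be negative; failure of the conclusion shows that the closed disc is not empty.
   The point [z0] is the default for indices without a bad point. *)
have [z0 z0r] : exists z0 : C, cmod z0 <= r.
  have [j /= nj] := filter_ex A; apply: contrapT => nz; apply: nj => z zr.
  by case: nz; exists z.
have Hzz j : exists z : C, cmod z <= r /\
    ((forall z, cmod z <= r -> cmod (h j z - v z) <= e) \/ e < cmod (h j z - v z)).
  have [b|nb] := pselect (forall z, cmod z <= r -> cmod (h j z - v z) <= e).
    by exists z0; split=> //; left.
  apply: contrapT => ne; apply: nb => z zr; rewrite leNgt; apply/negP => hz.
  by apply: ne; exists z; split=> //; right.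
have [zz Hz] := boolp.choice Hzz.
have [l Hl] := ultra_bounded HU (fun j => proj1 (Hz j)).
have lr := ucvg_le HU Hl (fun j => proj1 (Hz j)).
have Q1 : 0 < Q + 1 by rewrite ltr_wpDl.
have e3 : 0 < e / 3 by rewrite divr_gt0.
have eQ : 0 < e / 3 / (Q + 1) by rewrite divr_gt0.
have [j [[/= nj h1] h2]] := filter_ex (filterI (filterI A (Hl _ eQ)) (Hv l (dsc l lr) _ e3)).
have [zr [//|hz]] := Hz j; exfalso; move: hz; apply/negP; rewrite -leNgt.
have q1 : Q * cmod (zz j - l) <= e / 3.
  move: h1; rewrite ltr_pdivlMr// => h1; have := cmod_ge0 (zz j - l); lra.
have -> : h j (zz j) - v (zz j) = (h j (zz j) - h j l) + (h j l - v l) - (v (zz j) - v l) by ring.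
have := HQ j l (zz j) lr zr; have := vQ l (zz j) lr zr.
have := cmodB ((h j (zz j) - h j l) + (h j l - v l)) (v (zz j) - v l).
have := cmodD (h j (zz j) - h j l) (h j l - v l).
move: h2 => /=; lra.
Qed.

(** Members of [U] contain arbitrarily large indices, so [phi] can be chosen recursively, with a
    requirement that sharpens with [i]; this recovers the subsequence that [compact_op] asks for. *)
Lemma ultra_subsequence (P : nat -> nat -> Prop) : (forall i, U [set j | P i j]%classic) ->
  exists phi : nat -> nat, (forall i, (phi i < phi i.+1)%N) /\ forall i, P i (phi i).
Proof.
move=> HP; have PU' : ProperFilter U by case: HU => -[].
have Hx (x : nat * nat) : exists j, P x.1 j /\ (x.2 < j)%N.
  have h : U ([set j | P x.1 j] `&` [set j | (x.2 < j)%N])%classic.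
    by apply: filterI; [exact: HP|exact: (free_ultra_ge x.2.+1 HU)].
  by have [j [h1 h2]] := filter_ex h; exists j.
have [s Hs] := boolp.choice Hx.
pose phi := fix phi i := if i is j.+1 then s (j.+1, phi j) else s (0, 0)%N.
exists phi; split=> [i|]; first by have [_] := Hs (i.+1, phi i).
by case=> [|i]; [have [] := Hs (0, 0)%N|have [] := Hs (i.+1, phi i)].
Qed.

End MontelLimit.

(** * Test functions *)

Section TestFunction.
Variable R : realType.
Local Notation C := (R[i])^o.

Lemma cmod_sqr (z : C) : cmod z ^+ 2 = complex.Re z ^+ 2 + complex.Im z ^+ 2.
Proof. by rewrite /cmod sqr_sqrtr// addr_ge0 ?sqr_ge0. Qed.

Lemma dern_vanish (m : nat) (a : C) (h : C -> C) : holo h -> disc a ->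
  forall j, (j <= m)%N ->
  dern j (fun z => (z - a) ^+ m * h z) a = if j == m then m`!%:R * h a else 0.
Proof.
move=> Hh ad; elim: m => [|m IH] j jm.
  move: jm; by rewrite leqn0 => /eqP -> /=; rewrite fact0 !mul1r.
pose f1 (z : C) := (z - a) ^+ m * h z.
have hX : holo (fun z : C => (z - a) ^+ m).
  apply: cder_holo => z zd; eexists.
  exact: (der_comp (derB (cder_id z) (der_cst _ a z)) (cder_exp _ m)).
have Hf1 : holo f1 := holoM hX Hh.
(* Leibniz' rule for [(z - a) * f1], as a chain for [dern_jet]; at [k = 0] the factor [k%:R] cancels
   the spurious [k.-1]. *)
pose G k (z : C) := (z - a) * dern k f1 z + k%:R * dern k.-1 f1 z.
have GP : forall k z, disc z -> cder (G k) z (G k.+1 z).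
  move=> k z zd.
  have alg (x y w : C) : (1 - 0) * x + (z - a) * y + k%:R * w = (z - a) * y + (x + k%:R * w).
    by ring.
  have d1 := derM (derB (cder_id z) (der_cst _ a z)) (dern_cder k Hf1 zd).
  have d2 := derZ k%:R (dern_cder k.-1 Hf1 zd).
  have -> : G k.+1 z = (z - a) * dern k.+1 f1 z + (dern k f1 z + k%:R * dern k.-1.+1 f1 z).
    rewrite /G -[k.+1%:R]natr1 [(k%:R + 1) * _]mulrDl mul1r [_ + dern _ _ _]addrC /=; congr (_ + (_ + _)).
    by case: k {alg d1 d2} => [|k] /=; rewrite ?mul0r.
  by rewrite -alg; exact: (derD d1 d2).
have E : forall z, disc z -> (z - a) ^+ m.+1 * h z = G 0%N z.
  by move=> z zd; rewrite /G mul0r addr0 exprS -mulrA.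
rewrite (dern_jet GP j E ad) /G subrr mul0r add0r.
case: j jm => [|j] jm; first by rewrite mul0r.
rewrite (IH j jm) eqSS; case: eqP => [->|_]; last by rewrite mulr0.
by rewrite factS natrM mulrA.
Qed.

Variables (alpha : R) (p m : nat).
Hypotheses (alpha0 : 0 < alpha) (alphap : alpha <= p%:R).

Let mp := (m.+1 + p)%N.

Definition blaschke_den (a z : C) : C := 1 - (a^*)%C * z.

(** The exponent complements [alpha] to [p + 1], the power of the denominator left in the derivative
    of the test function. It is at least 1 because [alpha <= p], so the scale tends to 0 at the
    boundary. *)
Definition test_scale (a : C) : R := weight a `^ (p%:R + 1 - alpha).

(* The powers make [test_fun a] bounded in the Bloch space uniformly in [a], while
   it vanishes at [a] to the order [m.+1] exactly. *)
Definition test_fun (a z : C) : C :=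
  (z - a) ^+ m.+1 * ((test_scale a)%:C%C * (blaschke_den a z)^-1 ^+ mp).

(** The first bound is the identity |1 - conj(a) z|^2 - |z - a|^2 = (1 - |a|^2)(1 - |z|^2); the
    others follow from |1 - conj(a) z| >= 1 - |a||z|. *)
Lemma blaschke_den_ge (a z : C) : disc a -> disc z ->
  [/\ cmod (z - a) <= cmod (blaschke_den a z), 1 - cmod a <= cmod (blaschke_den a z) &
      1 - cmod z <= cmod (blaschke_den a z)].
Proof.
rewrite /disc /= => a1 z1; have a0 := cmod_ge0 a; have z0 := cmod_ge0 z.
have ac : cmod (a^*)%C = cmod a by rewrite /cmod; case: a {a1 a0} => x y /=; rewrite sqrrN.
have h : 1 - cmod a * cmod z <= cmod (blaschke_den a z).
  by have := cmod_sub 1 ((a^*)%C * z); rewrite cmod1 cmodM ac.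
split; [|nra|nra].
rewrite -(@ler_pXn2r _ 2)// ?nnegrE ?cmod_ge0// -subr_ge0.
have -> : cmod (blaschke_den a z) ^+ 2 - cmod (z - a) ^+ 2 = (1 - cmod a ^+ 2) * (1 - cmod z ^+ 2).
  by rewrite !cmod_sqr /blaschke_den; case: a {a1 a0 ac h} => x y; case: z {z1 z0} => u v /=; ring.
by rewrite mulr_ge0// subr_ge0 expr_le1// ltW.
Qed.

Lemma blaschke_den_neq0 (a z : C) : disc a -> disc z -> blaschke_den a z != 0.
Proof.
move=> ad zd; have [_ h _] := blaschke_den_ge ad zd.
by rewrite -cmod_gt0; apply: lt_le_trans h; rewrite subr_gt0.
Qed.

Lemma blaschke_den_diag (a : C) : blaschke_den a a = (weight a)%:C%C.
Proof.
rewrite /weight cmod_sqr /blaschke_den; case: a => x y; apply/eqP; rewrite eq_complex /=.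
by apply/andP; split; apply/eqP; ring.
Qed.

Lemma test_scale_gt0 a : disc a -> 0 < test_scale a.
Proof. by move=> ad; rewrite powR_gt0 ?weight_gt0. Qed.

Let cder_den a z : cder (blaschke_den a) z (- (a^*)%C).
Proof.
have := derB (der_cst _ (1 : C) z) (derZ (a^*)%C (cder_id z)).
by rewrite mulr1 sub0r.
Qed.

Let cder_denV k a z : disc a -> disc z ->
  cder (fun x => (blaschke_den a x)^-1 ^+ k) z (k%:R * (a^*)%C * (blaschke_den a z)^-1 ^+ k.+1).
Proof.
move=> ad zd; have q0 := blaschke_den_neq0 ad zd.
have h := der_comp (der_comp (cder_den a z) (cder_inv q0)) (cder_exp _ k).
suff <- : k%:R * (blaschke_den a z)^-1 ^+ k.-1 * (- blaschke_den a z ^- 2 * - (a^*)%C) =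
   k%:R * (a^*)%C * (blaschke_den a z)^-1 ^+ k.+1 by exact: h.
move: (blaschke_den a z) q0 => q q0.
case: k {h} => [|k]; first by rewrite !mul0r.
by rewrite /= !exprS; move: (q^-1 ^+ k) => x; field.
Qed.

Lemma holo_test_kernel a : disc a -> holo (fun z => (test_scale a)%:C%C * (blaschke_den a z)^-1 ^+ mp).
Proof.
move=> ad; apply: cder_holo => z zd; eexists; exact: (derZ _ (cder_denV mp ad zd)).
Qed.

Let test_derivative (a z : C) : C := m.+1%:R * (z - a) ^+ m * ((test_scale a)%:C%C * (blaschke_den a z)^-1 ^+ mp) +
  (z - a) ^+ m.+1 * ((test_scale a)%:C%C * (mp%:R * (a^*)%C * (blaschke_den a z)^-1 ^+ mp.+1)).

Let cder_test a z : disc a -> disc z -> cder (test_fun a) z (test_derivative a z).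
Proof.
move=> ad zd.
have h1 := der_comp (derB (cder_id z) (der_cst _ a z)) (cder_exp _ m.+1).
have := derM h1 (derZ (test_scale a)%:C%C (cder_denV mp ad zd)).
by rewrite subr0 mulr1.
Qed.

Lemma holo_test a : disc a -> holo (test_fun a).
Proof. by move=> ad; apply: cder_holo => z zd; eexists; exact: cder_test. Qed.

Definition test_bound : R := 2 `^ (p%:R + 1) * (m.+1 + mp)%:R.

(** Since [cmod (z - a) <= q], all but [p.+1] powers of the denominator cancel in both terms of the
    derivative; these absorb the weights of [z] and [a], each at most [2 * q]. *)
Lemma wbound_test a : disc a -> wbound alpha test_bound (derive1 (test_fun a)).
Proof.
move=> ad z zd; rewrite (cder_derive1E (cder_test ad zd)).
have [h1 h2 h3] := blaschke_den_ge ad zd.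
have q0 : 0 < cmod (blaschke_den a z) by rewrite cmod_gt0 blaschke_den_neq0.
have s0 := test_scale_gt0 ad.
have ac : cmod (a^*)%C <= 1.
  by rewrite (_ : cmod _ = cmod a) ?ltW// /cmod; case: (a) => x y /=; rewrite sqrrN.
set q := cmod (blaschke_den a z) in h1 h2 h3 q0 *.
have zaX k : cmod (z - a) ^+ k <= q ^+ k by rewrite lerXn2r// nnegrE ?cmod_ge0// ltW.
have sC : cmod ((test_scale a)%:C%C : C) = test_scale a by rewrite cmod_real gtr0_norm.
have T : cmod (test_derivative a z) <= test_scale a * (m.+1 + mp)%:R / q ^+ p.+1.
  apply: (le_trans (cmodD _ _)); rewrite natrD mulrDr mulrDl; apply: lerD.
    rewrite !cmodM sC !cmodX cmodV -/q -(rmorph_nat (@real_complex R)) cmod_real normr_nat.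
    have -> : test_scale a * m.+1%:R / q ^+ p.+1 = m.+1%:R * q ^+ m * (test_scale a * q^-1 ^+ mp).
      rewrite /mp addSnnS exprVn exprD; field; rewrite ?expf_neq0 ?gt_eqF//.
    apply: ler_wpM2r; first by rewrite mulr_ge0 ?exprn_ge0 ?invr_ge0// ltW.
    by rewrite ler_wpM2l.
  rewrite cmodM cmodX cmodM sC cmodM cmodX cmodV -/q cmodM -(rmorph_nat (@real_complex R)) cmod_real normr_nat.
  have -> : test_scale a * mp%:R / q ^+ p.+1 = q ^+ m.+1 * (test_scale a * (mp%:R * 1 * q^-1 ^+ mp.+1)).
    rewrite mulr1 /mp -addnS exprVn exprD; field; rewrite ?expf_neq0 ?gt_eqF//.
  apply: ler_pM => //; rewrite ?exprn_ge0 ?cmod_ge0//.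
    by rewrite mulr_ge0 ?(ltW s0)// mulr_ge0 ?exprn_ge0 ?invr_ge0 ?(ltW q0)// mulr_ge0 ?cmod_ge0.
  apply: ler_wpM2l; first exact: ltW.
  apply: ler_wpM2r; first by rewrite exprn_ge0// invr_ge0 ltW.
  by rewrite ler_wpM2l.
apply: (le_trans (ler_wpM2l (powR_ge0 _ _) T)).
have q20 : 0 < 2 * q by rewrite mulr_gt0.
have W : weight z `^ alpha * test_scale a <= 2 `^ (p%:R + 1) * q ^+ p.+1.
  have -> : 2 `^ (p%:R + 1) * q ^+ p.+1 = (2 * q) `^ alpha * (2 * q) `^ (p%:R + 1 - alpha).
    rewrite -powRD; last by rewrite (gt_eqF q20) implybT.
    have -> : alpha + (p%:R + 1 - alpha) = p%:R + 1 by ring.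
    rewrite powRM ?ltW//; congr (_ * _).
    by rewrite natr1 powR_mulrn// ltW.
  have ww x : disc x -> 1 - cmod x <= q -> weight x <= 2 * q.
    by move=> xd xq; apply: (le_trans (weight_le x)); rewrite ler_wpM2l.
  apply: ler_pM; rewrite ?powR_ge0//; apply: ge0_ler_powR; rewrite ?nnegrE.
  - exact: ltW.
  - exact/ltW/weight_gt0.
  - exact: ltW.
  - exact: ww.
  - by rewrite subr_ge0; apply: (le_trans alphap); rewrite lerDl.
  - exact/ltW/weight_gt0.
  - exact: ltW.
  - exact: ww.
rewrite /test_bound !mulrA ler_pdivrMr ?exprn_gt0//.
by rewrite [leRHS]mulrAC ler_wpM2r.
Qed.

Lemma test_scale_le a : disc a -> test_scale a <= weight a.
Proof.
move=> ad; have w0 := weight_gt0 ad; have w1 := weight_le1 a.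
rewrite /test_scale (_ : p%:R + 1 - alpha = (p%:R - alpha) + 1); last by ring.
rewrite powRD ?(gt_eqF w0) ?implybT// (powRr1 (ltW w0)) -[leRHS]mul1r.
apply: ler_wpM2r; first exact: ltW.
have h1 : 1 `^ (p%:R - alpha) = 1 :> R by rewrite powR1.
rewrite -[leRHS]h1.
by apply: ge0_ler_powR; rewrite ?nnegrE; [rewrite subr_ge0|exact: ltW| |].
Qed.

Lemma test_in_bloch a : disc a -> in_bloch alpha (test_fun a).
Proof. by move=> ad; split; [exact: holo_test|eexists; exact: wbound_test]. Qed.

Lemma test_norm_le a : disc a -> bloch_norm alpha (test_fun a) <= 1 + test_bound.
Proof.
move=> ad; apply: (le_trans (bloch_norm_le (wbound_test ad))); rewrite lerD2r.
rewrite /test_fun sub0r /blaschke_den mulr0 subr0 invr1 expr1n mulr1 cmodM cmodX cmodN.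
rewrite cmod_real ger0_norm ?(ltW (test_scale_gt0 _))//.
have a1 : cmod a < 1 := ad.
rewrite -[leRHS]mulr1; apply: ler_pM; rewrite ?exprn_ge0 ?cmod_ge0//.
- exact/ltW/test_scale_gt0.
- by rewrite exprn_ile1 ?cmod_ge0// ltW.
- exact: (le_trans (test_scale_le ad) (weight_le1 a)).
Qed.

Lemma test_dern0 a j : disc a -> (j <= m)%N -> dern j (test_fun a) a = 0.
Proof.
move=> ad jm; rewrite /test_fun (dern_vanish (holo_test_kernel ad) ad (leqW jm)).
by rewrite ltn_eqF.
Qed.

(** At [a] the denominator is [weight a], and (p + 1 - alpha) - (m + 1 + p) = -(alpha + m): the
    maximal growth rate of the derivative of order [m.+1] is attained. *)
Lemma test_dern_top a : disc a ->
  cmod (dern m.+1 (test_fun a) a) * weight a `^ (alpha + m%:R) = m.+1`!%:R.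
Proof.
move=> ad; rewrite /test_fun (dern_vanish (holo_test_kernel ad) ad (leqnn _)) eqxx.
have w0 := weight_gt0 ad.
rewrite blaschke_den_diag !cmodM cmodX cmodV !cmod_real -(rmorph_nat (@real_complex R)) cmod_real.
rewrite normr_nat (gtr0_norm (test_scale_gt0 ad)) (gtr0_norm w0) -mulrA.
suff -> : test_scale a * (weight a)^-1 ^+ mp * weight a `^ (alpha + m%:R) = 1 by rewrite mulr1.
rewrite mulrAC /test_scale -powRD; last by rewrite (gt_eqF w0) implybT.
have -> : p%:R + 1 - alpha + (alpha + m%:R) = mp%:R by rewrite /mp natrD -natr1; ring.
by rewrite powR_mulrn ?ltW// exprVn divff// expf_neq0// gt_eqF.
Qed.

(** Around a fixed [z] the denominators stay above [rho] for all [a], while [test_scale a] is at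
    most [2 * (1 - cmod a)]; Cauchy's estimates carry this decay to every derivative. *)
Lemma test_dern_small k z : disc z -> exists2 Q : R, 0 <= Q & forall a, disc a ->
  cmod (dern k (test_fun a) z) <= Q * (1 - cmod a).
Proof.
move=> zd; have z1 : cmod z < 1 := zd; have [B B0 HB] := @dern_estimate R k.
pose rho := (1 - cmod z) / 2.
have rho0 : 0 < rho by rewrite divr_gt0// subr_gt0.
have zr : cmod z + rho < 1 by rewrite /rho; lra.
pose N : R := 2 ^+ m.+1 * 2 / rho ^+ mp.
have N0 : 0 < N by rewrite divr_gt0 ?exprn_gt0// mulr_gt0// exprn_gt0.
exists (B * N / rho ^+ k); first by apply/ltW; rewrite divr_gt0 ?exprn_gt0// mulr_gt0.
move=> a ad; have a1 : cmod a < 1 := ad.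
rewrite mulrAC ler_pdivlMr ?exprn_gt0// mulrC -mulrA.
apply: (HB _ _ _ _ (@holo_test a ad) rho0 zr) => x xz.
have xr : cmod x <= 1 - rho by have := cmod_sub x z; rewrite /rho in xz *; lra.
have xd : disc x by rewrite /disc /=; lra.
have [_ _ h3] := blaschke_den_ge ad xd.
have qr : rho <= cmod (blaschke_den a x) by lra.
rewrite /test_fun !cmodM !cmodX cmodV cmod_real (gtr0_norm (test_scale_gt0 ad)).
have -> : N * (1 - cmod a) = 2 ^+ m.+1 * (2 * (1 - cmod a) * rho^-1 ^+ mp).
  by rewrite /N exprVn; ring.
have xa : cmod (x - a) <= 2 by have := cmodB x a; rewrite /disc /= in xd; lra.
apply: ler_pM; rewrite ?exprn_ge0 ?cmod_ge0//.
- by rewrite mulr_ge0 ?exprn_ge0 ?invr_ge0 ?cmod_ge0// ltW// test_scale_gt0.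
- by rewrite lerXn2r ?nnegrE ?cmod_ge0.
apply: ler_pM; rewrite ?exprn_ge0 ?invr_ge0 ?cmod_ge0//.
- exact/ltW/test_scale_gt0.
- exact: (le_trans (test_scale_le ad) (weight_le a)).
by rewrite lerXn2r ?nnegrE ?invr_ge0 ?cmod_ge0 ?(ltW rho0)// lef_pV2// posrE; apply: lt_le_trans qr.
Qed.

End TestFunction.

(** * Splitting the sum of operators *)

Section Operators.
Variable R : realType.
Local Notation C := (R[i])^o.
Local Notation op := ((C -> C) -> C -> C).
Variables (alpha beta : R) (n : nat).
Hypotheses (alpha0 : 0 < alpha) (beta0 : 0 < beta).

Local Notation wbounded := (@wbounded R alpha beta n).
Local Notation wcompact := (@wcompact R alpha beta n).
Local Notation c := (beta + n%:R).

Lemma wbounded0 : wbounded (fun _ _ => 0).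
Proof. by exists 0 => f _ z _; rewrite cmod0 mulr0 mul0r. Qed.

Lemma wboundedB (L1 L2 : op) : wbounded L1 -> wbounded L2 -> wbounded (fun f z => L1 f z - L2 f z).
Proof.
move=> [K1 H1] [K2 H2]; exists (K1 + K2) => f Hf; rewrite mulrDl.
exact: (wboundD (H1 f Hf) (wboundN (H2 f Hf))).
Qed.

Lemma wcompact0 : wcompact (fun _ _ => 0).
Proof.
have z0 : wbound c 0 (fun _ : C => 0) by move=> z _; rewrite cmod0 mulr0.
split=> [f _|u _ _]; first by exists 0.
exists id; split=> //; exists (fun=> 0); split; [exact: holo_cst|by exists 0|].
move=> e e0; exists 0%N => j _; apply: wbound_le (ltW e0) _.
by move=> z _; rewrite subrr cmod0 mulr0.
Qed.

Lemma increasing_ge (phi : nat -> nat) : (forall j, (phi j < phi j.+1)%N) -> forall j, (j <= phi j)%N.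
Proof. by move=> H; elim=> // j IH; apply: leq_ltn_trans (H j). Qed.

Lemma increasing_comp (phi psi : nat -> nat) : (forall j, (phi j < phi j.+1)%N) ->
  (forall j, (psi j < psi j.+1)%N) -> forall j, (phi (psi j) < phi (psi j.+1))%N.
Proof.
move=> H H' j; have mono i k : (i < k)%N -> (phi i < phi k)%N.
  elim: k => // k IH; rewrite ltnS leq_eqVlt => /orP[/eqP ->|/IH] //.
  by move=> h; apply: ltn_trans h _.
exact: mono.
Qed.

Lemma wcompactB (L1 L2 : op) : wcompact L1 -> wcompact L2 -> wcompact (fun f z => L1 f z - L2 f z).
Proof.
move=> [I1 H1] [I2 H2]; split=> [f Hf|u Hu [M HM]].
  have [M1 h1] := I1 f Hf; have [M2 h2] := I2 f Hf; exists (M1 + M2).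
  exact: (wboundD h1 (wboundN h2)).
have [phi [phiS [A [HA [MA bA] cA]]]] := H1 u Hu (ex_intro _ M HM).
have [psi [psiS [B [HB [MB bB] cB]]]] := H2 (fun j => u (phi j)) (fun j => Hu (phi j))
  (ex_intro _ M (fun j => HM (phi j))).
exists (fun j => phi (psi j)); split; first exact: increasing_comp.
exists (fun z => A z - B z); split; first exact: (holoB HA HB).
  by exists (MA + MB); exact: (wboundD bA (wboundN bB)).
move=> e e0; have e2 : 0 < e / 2 by rewrite divr_gt0.
have [N1 h1] := cA _ e2; have [N2 h2] := cB _ e2.
exists (maxn N1 N2) => j; rewrite geq_max => /andP[j1 j2].
have := wboundD (h1 _ (leq_trans j1 (increasing_ge psiS j))) (wboundN (h2 _ j2)).
rewrite -splitr; apply: wbound_eq => z _; ring.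
Qed.

Variable G : nat -> C -> C.
Hypothesis G_holo : forall k, holo (G k).

Definition term_op (k : nat) : op := fun f z => dern k f z * G k z.

Definition partial_op (m : nat) : op := fun f z => \sum_(k < m) term_op k f z.

(** [P] is abstract so that it can be [wbounded] or [wcompact]. Closure under differences and 0
    yields sums as A - (0 - B), and the descent ends because [partial_op 1] is [term_op 0]. *)
Lemma downward_induction (P : op -> Prop) : P (fun _ _ => 0) ->
  (forall L1 L2, P L1 -> P L2 -> P (fun f z => L1 f z - L2 f z)) ->
  (forall m, P (partial_op m.+2) -> P (term_op m.+1)) ->
  forall m, P (partial_op m) <-> forall k, (k < m)%N -> P (term_op k).
Proof.
move=> P0 PB Pstep m; split.
  elim: m => [//|[|m] IH] H k km.
    move: km; rewrite ltnS leqn0 => /eqP ->.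
    suff <- : partial_op 1 = term_op 0 by exact: H.
    by apply/funext => f; apply/funext => z; rewrite /partial_op big_ord1.
  have Hm := Pstep _ H.
  move: km; rewrite ltnS leq_eqVlt => /orP[/eqP -> //|km]; apply: IH km.
  suff <- : (fun f z => partial_op m.+2 f z - term_op m.+1 f z) = partial_op m.+1 by exact: PB.
  by apply/funext => f; apply/funext => z; rewrite /partial_op [X in X - _]big_ord_recr /= addrK.
elim: m => [_|m IH H].
  suff -> : partial_op 0 = fun _ _ => 0 by [].
  by apply/funext => f; apply/funext => z; rewrite /partial_op big_ord0.
have -> : partial_op m.+1 = fun f z => partial_op m f z - (0 - term_op m f z); last first.
  apply/PB; first by apply: IH => k km; exact: (H k (leqW km)).
  exact: (PB _ _ P0 (H m (leqnn _))).
apply/funext => f; apply/funext => z.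
by rewrite /partial_op big_ord_recr /= sub0r opprK.
Qed.

(** * Recovering the term of highest order from the sum *)

Section Step.
Variables (m p : nat).
Hypothesis alphap : alpha <= p%:R.

Local Notation tf := (test_fun alpha p m).

Lemma partial_op_test a : disc a -> partial_op m.+2 (tf a) a = dern m.+1 (tf a) a * G m.+1 a.
Proof.
move=> ad; rewrite /partial_op big_ord_recr /= big1 ?add0r// => k _.
by rewrite /term_op test_dern0 ?mul0r// -ltnS.
Qed.

Lemma coefficient_le a (X : R) : disc a ->
  weight a `^ c * cmod (partial_op m.+2 (tf a) a) <= X ->
  weight a `^ c * cmod (G m.+1 a) <= X * weight a `^ (alpha + m%:R).
Proof.
move=> ad H; apply: le_trans (ler_wpM2r (powR_ge0 _ _) H).
rewrite partial_op_test// cmodM -!mulrA; apply: ler_wpM2l; first exact: powR_ge0.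
rewrite mulrA mulrAC test_dern_top// -[leLHS]mul1r; apply: ler_wpM2r; first exact: cmod_ge0.
by rewrite ler1n fact_gt0.
Qed.

Lemma wbound_dern_bloch : exists2 B : R, 0 < B & forall f, in_bloch alpha f ->
  wbound (alpha + m%:R) (B * bloch_norm alpha f) (dern m.+1 f).
Proof.
have [B B0 HB] := wbound_dern m (ltW alpha0); exists B; first exact: B0.
move=> f Hf; rewrite (dernSr m f).
exact: (HB _ _ (holo_derive1 (proj1 Hf)) (wbound_bloch_norm Hf)).
Qed.

Lemma wbound_product (X M : R) (h : C -> C) : 0 <= X ->
  (forall a, disc a -> weight a `^ c * cmod (G m.+1 a) <= X * weight a `^ (alpha + m%:R)) ->
  wbound (alpha + m%:R) M h -> wbound c (X * M) (fun z => h z * G m.+1 z).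
Proof.
move=> X0 HX Hh z zd; rewrite cmodM [cmod (h z) * _]mulrC mulrA.
apply: (le_trans (ler_wpM2r (cmod_ge0 _) (HX z zd))).
by rewrite -mulrA; apply: ler_wpM2l => //; exact: Hh.
Qed.

Lemma wbounded_of_coefficient (X : R) : 0 <= X ->
  (forall a, disc a -> weight a `^ c * cmod (G m.+1 a) <= X * weight a `^ (alpha + m%:R)) ->
  wbounded (term_op m.+1).
Proof.
move=> X0 HX; have [B B0 HB] := wbound_dern_bloch; exists (X * B) => f Hf; rewrite -mulrA.
exact: (wbound_product X0 HX (HB f Hf)).
Qed.

Lemma wbounded_step : wbounded (partial_op m.+2) -> wbounded (term_op m.+1).
Proof.
(* The absolute value is taken because the constant [K] of [wbounded] may be negative. *)
move=> [K HK]; pose X := `|K| * (1 + test_bound R p m).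
have T0 : 0 <= 1 + test_bound R p m by rewrite addr_ge0// mulr_ge0 ?powR_ge0.
apply: (@wbounded_of_coefficient X); first by rewrite mulr_ge0.
move=> a ad; apply: coefficient_le => //.
apply: (le_trans (HK _ (test_in_bloch m alpha0 alphap ad) a ad)).
apply: (@le_trans _ _ (`|K| * bloch_norm alpha (tf a))).
  apply: ler_wpM2r; last exact: ler_norm.
  exact: (bloch_norm_ge0 (test_in_bloch m alpha0 alphap ad)).
apply: ler_wpM2l; first exact: normr_ge0.
exact: test_norm_le.
Qed.

(* Otherwise a sequence of test functions would contradict compactness: it is
   bounded and tends to 0 pointwise, so that the only possible limit is 0. *)
Lemma coefficient_small (e : R) : wcompact (partial_op m.+2) -> 0 < e ->
  exists2 r : R, r < 1 & forall a, disc a -> r < cmod a ->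
    weight a `^ c * cmod (G m.+1 a) <= e * weight a `^ (alpha + m%:R).
Proof.
move=> [_ Hc] e0; apply: contrapT => Hn.
have Ha i : exists a : C, [/\ disc a, 1 - i.+1%:R^-1 < cmod a &
    e * weight a `^ (alpha + m%:R) < weight a `^ c * cmod (G m.+1 a)].
  apply: contrapT => Hi; apply: Hn; exists (1 - i.+1%:R^-1).
    by rewrite gtrBl invr_gt0 ltr0n.
  move=> a ad ra; rewrite leNgt; apply/negP => h; apply: Hi; by exists a.
have [a aP] := boolp.choice Ha.
have ad i : disc (a i) by case: (aP i).
have [|phi [phiS [H [HH _ cv]]]] := Hc (fun i => tf (a i)) (fun i => test_in_bloch m alpha0 alphap (ad i)).
  by exists (1 + test_bound R p m) => i; exact: test_norm_le.
have H0 z : disc z -> H z = 0.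
  move=> zd.
  have [Q HQ] : {Q : nat -> R & forall k, 0 <= Q k /\ forall a, disc a ->
      cmod (dern k (tf a) z) <= Q k * (1 - cmod a)}.
    apply: (@boolp.choice _ _ (fun k (q : R) => 0 <= q /\ forall a, disc a ->
      cmod (dern k (tf a) z) <= q * (1 - cmod a))) => k.
    by have [q q0 hq] := test_dern_small m alphap k zd; exists q.
  pose Q' := \sum_(k < m.+2) Q k * cmod (G k z).
  have Q'0 : 0 <= Q' by apply: sumr_ge0 => k _; rewrite mulr_ge0 ?cmod_ge0//; case: (HQ k).
  have SQ i : cmod (partial_op m.+2 (tf (a i)) z) <= Q' * (1 - cmod (a i)).
    apply: (le_trans (cmod_sum _ _)); rewrite mulr_suml; apply: ler_sum => k _.
    rewrite /term_op cmodM mulrAC; apply: ler_wpM2r; first exact: cmod_ge0.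
    by have [_] := HQ k; apply.
  apply/eqP; rewrite -cmod_eq0 eq_le cmod_ge0 andbT; apply/ler_addgt0Pr => d d0; rewrite add0r.
  have w0 : 0 < weight z `^ c by rewrite powR_gt0 ?weight_gt0.
  have d2 : 0 < d / 2 by rewrite divr_gt0.
  have [N HN] := cv (weight z `^ c * (d / 2)) (mulr_gt0 w0 d2).
  have Qd : 0 < d / 2 / (Q' + 1) by rewrite divr_gt0// ltr_wpDl.
  have [U HU] := free_ultra_ex.
  have PU : ProperFilter U by case: HU => -[].
  have [j [/= h1 h2]] := filter_ex (filterI (free_ultra_ge N HU) (free_ultra_inv HU Qd)).
  have := HN j h1 z zd; rewrite ler_pM2l// => h3.
  have h4 := SQ (phi j).
  have h5 : Q' * (1 - cmod (a (phi j))) <= d / 2.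
    have [_ h6 _] := aP (phi j).
    have h7 : (phi j).+1%:R^-1 <= j.+1%:R^-1 :> R.
      by rewrite lef_pV2 ?posrE ?ltr0n// ler_nat ltnS increasing_ge.
    have h6' : 1 - cmod (a (phi j)) <= (phi j).+1%:R^-1 by rewrite lerBlDr -lerBlDl ltW.
    have h8 := le_trans h6' (le_trans h7 (ltW h2)).
    apply: (le_trans (ler_wpM2l Q'0 h8)).
    rewrite mulrCA -[leRHS]mulr1; apply: ler_wpM2l; first exact: ltW.
    by rewrite ler_pdivrMr ?mul1r ?lerDl// ltr_wpDl.
  have -> : H z = partial_op m.+2 (tf (a (phi j))) z - (partial_op m.+2 (tf (a (phi j))) z - H z) by ring.
  apply: (le_trans (cmodB _ _)); lra.
(* With limit 0, convergence at the point [a (phi N)] gives exactly the estimate that the choice of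
   [a] excludes. *)
have [N HN] := cv e e0.
have [_ _] := aP (phi N); apply/negP; rewrite -leNgt.
apply: coefficient_le => //.
by have := HN N (leqnn N) _ (ad (phi N)); rewrite (H0 _ (ad _)) subr0.
Qed.

(** Compactness through [closed_disc_uniform], where the radius doubles as the reciprocal of a bound
    for [g]. *)
Lemma holo_bounded_ball (g : C -> C) (r : R) : holo g -> r < 1 ->
  exists2 M : R, 0 < M & forall z, cmod z <= r -> cmod (g z) <= M.
Proof.
move=> Hg r1.
have [d d0 H] : exists2 d : R, 0 < d & forall z : C, cmod z <= r -> d * cmod (g z) <= 1.
  apply: (@closed_disc_uniform R r (fun z d => d * cmod (g z) <= 1)).
    by move=> z d d' h dd; apply: le_trans h; rewrite ler_wpM2r ?cmod_ge0.
  move=> z zr; have zd : disc z by apply: le_lt_trans r1.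
  have [d d0 L] := der_lip (holo_cder Hg zd).
  pose A := 1 + cmod (derive1 g z); have A0 : 0 < A by rewrite ltr_pwDl ?cmod_ge0.
  pose Mz := cmod (g z) + A * d; have M0 : 0 < Mz by rewrite ltr_wpDl ?cmod_ge0 ?mulr_gt0.
  exists (Num.min d Mz^-1); first by rewrite lt_min d0 invr_gt0.
  move=> w _; rewrite lt_min => /andP[wd _].
  have := L (w - z); rewrite [z + _]addrC subrK => /(_ wd) h.
  have gw : cmod (g w) <= Mz.
    have := cmod_sub (g w) (g z); have : A * cmod (w - z) <= A * d by rewrite ler_wpM2l ?ltW.
    by rewrite /Mz -/A in h *; lra.
  apply: (@le_trans _ _ (Mz^-1 * Mz)); last by rewrite mulVf// gt_eqF.
  apply: ler_pM; rewrite ?cmod_ge0//; last by rewrite ge_min lexx orbT.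
  by rewrite le_min (ltW d0) invr_ge0 ltW.
exists d^-1; first by rewrite invr_gt0.
by move=> z /H; rewrite mulrC -ler_pdivlMr// div1r.
Qed.

(** Beyond the radius [r] that [coefficient_small] gives for [e = 1] the constant is 1; within it
    [G m.+1] is bounded and the weight is at least [1 - r]. *)
Lemma coefficient_bounded : wcompact (partial_op m.+2) -> exists2 X : R, 0 <= X &
  forall a, disc a -> weight a `^ c * cmod (G m.+1 a) <= X * weight a `^ (alpha + m%:R).
Proof.
move=> Hc; have [r r1 Hr] := coefficient_small Hc ltr01.
have [M M0 HM] := holo_bounded_ball (@G_holo m.+1) r1.
have s0 : 0 < (1 - r) `^ (alpha + m%:R) by rewrite powR_gt0 ?subr_gt0.
exists (1 + M / (1 - r) `^ (alpha + m%:R)); first by rewrite addr_ge0// divr_ge0// ltW.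
move=> a ad; have p0 := powR_ge0 (weight a) (alpha + m%:R).
have q0 : 0 <= M / (1 - r) `^ (alpha + m%:R) by rewrite divr_ge0// ltW.
rewrite mulrDl; have [ar|ra] := leP (cmod a) r; last first.
  by apply: (le_trans (Hr a ad ra)); rewrite lerDl mulr_ge0.
apply: (@le_trans _ _ M); last first.
  apply: ler_wpDl; first by rewrite mul1r.
  rewrite mulrAC ler_pdivlMr// ler_pM2l//.
  apply: ge0_ler_powR; rewrite ?nnegrE.
  - by rewrite addr_ge0// ltW.
  - by rewrite subr_ge0 ltW.
  - exact/ltW/weight_gt0.
  - by apply: le_trans (weight_ge ad); rewrite lerD2l lerN2.
rewrite -[leRHS]mul1r; apply: ler_pM; rewrite ?powR_ge0 ?cmod_ge0 ?HM//.
have h1 : 1 `^ c = 1 :> R by rewrite powR1.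
rewrite -[leRHS]h1; apply: ge0_ler_powR; rewrite ?nnegrE.
- by rewrite addr_ge0// ltW.
- exact/ltW/weight_gt0.
- exact: ler01.
- exact: weight_le1.
Qed.

Lemma wcompact_step : wcompact (partial_op m.+2) -> wcompact (term_op m.+1).
Proof.
move=> Hc; have [X X0 HX] := coefficient_bounded Hc.
have [K HK] := wbounded_of_coefficient X0 HX.
have [B B0 HB] := wbound_dern_bloch.
split=> [f Hf|u Hu [M HM]]; first by eexists; exact: (HK f Hf).
pose h j := dern m.+1 (u j).
have h_holo j : holo (h j) by exact: (@holo_dern _ m.+1 _ (proj1 (Hu j))).
have g0 : 0 <= alpha + m%:R by rewrite addr_ge0// ltW.
have h_bound j : wbound (alpha + m%:R) (B * M) (h j).
  by apply: wbound_le (HB _ (Hu j)); apply: ler_wpM2l; [exact: ltW|exact: HM].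
have BM0 := wbound_ge0 (h_bound 0%N).
have [U HU] := free_ultra_ex.
have [v Hv] := ultra_pointwise HU g0 h_bound.
have v_holo := ultra_limit_holo HU g0 h_holo h_bound Hv.
have v_bound := ultra_limit_bound HU h_bound Hv.
(* The disc is cut at [r]: outside, the coefficient is so small that the bound [B * M + B * M] on
   [h j - v] is harmless; inside, the coefficient is at most [X] and [h j] tends to [v]
   uniformly. *)
have main (e : R) : 0 < e -> U [set j | wbound c e (fun z => h j z * G m.+1 z - v z * G m.+1 z)]%classic.
  move=> e0; pose N := B * M + B * M + 1; have N0 : 0 < N by rewrite ltr_wpDl// addr_ge0.
  have [r r1 Hr] := coefficient_small Hc (divr_gt0 e0 N0).
  have X1 : 0 < X + 1 by rewrite ltr_wpDl.
  have FU : Filter U by case: HU => -[[]].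
  apply: filterS (ultra_limit_uniform HU g0 h_holo h_bound Hv r1 (divr_gt0 e0 X1)) => j /= hj z zd.
  rewrite -mulrBl cmodM [cmod (h j z - v z) * _]mulrC mulrA.
  have [zr|rz] := leP (cmod z) r.
    apply: (@le_trans _ _ (X * (e / (X + 1)))).
      apply: ler_pM; rewrite ?mulr_ge0 ?powR_ge0 ?cmod_ge0//; last exact: hj.
      apply: (le_trans (HX z zd)); rewrite -[leRHS]mulr1; apply: ler_wpM2l => //.
      have h1 : 1 `^ (alpha + m%:R) = 1 :> R by rewrite powR1.
      rewrite -[leRHS]h1; apply: ge0_ler_powR; rewrite ?nnegrE ?ler01//.
        exact/ltW/weight_gt0.
      exact: weight_le1.
    rewrite mulrCA -[leRHS]mulr1; apply: ler_wpM2l; first exact: ltW.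
    by rewrite ler_pdivrMr ?mul1r ?lerDl.
  apply: (le_trans (ler_wpM2r (cmod_ge0 _) (Hr z zd rz))); rewrite -mulrA.
  have h2 := wboundD (h_bound j) (wboundN v_bound) zd.
  apply: (le_trans (ler_wpM2l (ltW (divr_gt0 e0 N0)) h2)).
  rewrite mulrAC -mulrA -[leRHS]mulr1; apply: ler_wpM2l; first exact: ltW.
  by rewrite ler_pdivrMr// mul1r /N lerDl.
have inv0 i : 0 < i.+1%:R^-1 :> R by rewrite invr_gt0 ltr0n.
have [phi [phiS Hphi]] := ultra_subsequence HU (fun i => main _ (inv0 i)).
exists phi; split; first exact: phiS.
exists (fun z => v z * G m.+1 z); split; first exact: (holoM v_holo (@G_holo m.+1)).
  by exists (X * (B * M)); exact: wbound_product.
move=> e e0; have PU : ProperFilter U by case: HU => -[].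
have [N /= HN] := filter_ex (free_ultra_inv HU e0).
exists N => j Nj; apply: wbound_le (Hphi j); apply: le_trans (ltW HN).
by rewrite lef_pV2 ?posrE ?ltr0n// ler_nat ltnS.
Qed.

End Step.
End Operators.

Theorem theoremA (R : realType) (alpha beta : R) (n : nat)
  (g : 'I_n -> (R[i])^o -> (R[i])^o) :
  0 < alpha -> 0 < beta -> (0 < n)%N ->
  (forall k : 'I_n, holo (g k)) ->
  (bounded_op alpha beta (Ig g) <->
     (forall k : 'I_n, bounded_op alpha beta (Ink n k (g k)))) /\
  (compact_op alpha beta (Ig g) <->
     (forall k : 'I_n, compact_op alpha beta (Ink n k (g k)))).
Proof.
move=> alpha0 beta0; case: n g => [g n_gt0|n0 g0 _ g_holo]; first by exfalso; move: n_gt0; rewrite ltnn.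
(* Extension by 0 keeps every [G k] holomorphic and lets the induction run over natural numbers
   instead of ordinals of varying type. *)
pose G k : (R[i])^o -> (R[i])^o := if insub k is Some i then g0 i else fun=> 0.
have GE (k : 'I_n0.+1) : G k = g0 k by rewrite /G valK.
have G_holo k : holo (G k).
  by rewrite /G; case: insub => [i|]; [exact: g_holo|exact: holo_cst].
have term_holo k f : holo f -> holo (term_op G k f).
  by move=> Hf; exact: (holoM (@holo_dern _ k f Hf) (G_holo k)).
have partial_holo m f : holo f -> holo (partial_op G m f).
  by move=> Hf; apply: holo_sum => k; exact: term_holo.
have IgE : Ig g0 = fun f => Iopn n0.+1 (partial_op G n0.+1 f).
  apply/funext => f; congr (Iopn _ _); apply/funext => z; apply: eq_bigr => k _.
  by rewrite /term_op GE.
have InkE (k : 'I_n0.+1) : Ink n0.+1 k (g0 k) = fun f => Iopn n0.+1 (term_op G k f).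
  by apply/funext => f; congr (Iopn _ _); apply/funext => z; rewrite /term_op GE.
(* This integer is the exponent [p] of the test functions. *)
have alphap : alpha <= (Num.bound alpha)%:R by rewrite ltW// archi_boundP// ltW.
have ordP (P : nat -> Prop) : (forall k, (k < n0.+1)%N -> P k) <-> forall k : 'I_n0.+1, P k.
  by split=> [H k|H k kn]; [exact: H|exact: (H (Ordinal kn))].
rewrite IgE; split.
  apply: (iff_trans (@bounded_opP R alpha beta n0 (partial_op G n0.+1) beta0 (partial_holo n0.+1))).
  have H := @downward_induction R G (wbounded alpha beta n0) (@wbounded0 R alpha beta n0)
    (@wboundedB R alpha beta n0) (fun m => @wbounded_step R alpha beta n0 alpha0 G m _ alphap) n0.+1.
  apply: (iff_trans H).
  apply: (iff_trans (ordP _)).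
  by split=> Hk k; [rewrite InkE; apply/(@bounded_opP R alpha beta n0 _ beta0 (term_holo k))
    |apply/(@bounded_opP R alpha beta n0 _ beta0 (term_holo k)); rewrite -InkE].
apply: (iff_trans (@compact_opP R alpha beta n0 (partial_op G n0.+1) beta0 (partial_holo n0.+1))).
have H := @downward_induction R G (wcompact alpha beta n0) (@wcompact0 R alpha beta n0)
  (@wcompactB R alpha beta n0)
  (fun m => @wcompact_step R alpha beta n0 alpha0 beta0 G G_holo m _ alphap) n0.+1.
apply: (iff_trans H).
apply: (iff_trans (ordP _)).
by split=> Hk k; [rewrite InkE; apply/(@compact_opP R alpha beta n0 _ beta0 (term_holo k))
  |apply/(@compact_opP R alpha beta n0 _ beta0 (term_holo k)); rewrite -InkE].
Qed.
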